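(* The Kostka-Foulkes polynomials $K^{D_n}_{\lambda,\mu}(q)$ for the root system $D_n$, for partitions $\lambda$ (with nonnegative last part) with $2\le|\lambda|\le3$ and $\mu$ with $|\mu|\le2$, are as follows (partitions are completed by zeros to length $n$; $\emptyset$ denotes the zero weight). $\lambda=(3)$: $K_{(3),(2)}=K_{(3),(1,1)}=K_{(3),\emptyset}=0$; $K_{(3),(1)}=q^2\,\frac{q^{2n-2}-1}{q^2-1}$. $\lambda=(2,1)$: $K_{(2,1),(2)}=K_{(2,1),(1,1)}=K_{(2,1),\emptyset}=0$; $K_{(2,1),(1)}=q^{n-1}+q\,\frac{q^{2n-3}-1}{q-1}$. $\lambda=(1,1,1)$: $K_{(1,1,1),(2)}=K_{(1,1,1),(1,1)}=K_{(1,1,1),\emptyset}=0$; $K_{(1,1,1),(1)}=q^{n-2}+q\,\frac{q^{2n-4}-1}{q^2-1}$. $\lambda=(2)$: $K_{(2),(2)}=1$; $K_{(2),(1,1)}=q$; $K_{(2),(1)}=0$; $K_{(2),\emptyset}=q^2\,\frac{q^{2n-2}-1}{q^2-1}$. $\lambda=(1,1)$: $K_{(1,1),(2)}=0$; $K_{(1,1),(1,1)}=1$; $K_{(1,1),(1)}=0$; $K_{(1,1),\emptyset}=q^{n-1}+q\,\frac{q^{2n-2}-1}{q^2-1}$.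
   Context: Write $\beta=(\beta_{\overline n},\dots,\beta_{\overline 1})$ for $\sum_i\beta_{\overline i}\varepsilon_{\overline i}$, $(\varepsilon_{\overline i})$ an orthonormal basis of $\mathbb R^n$; a partition $(\lambda_1\ge\lambda_2\ge\cdots)$ with at most $n$ parts is the dominant weight with $\lambda_{\overline n}=\lambda_1,\lambda_{\overline{n-1}}=\lambda_2,\dots$, and $|\lambda|$ is the sum of its parts. For type $D_n$ ($so_{2n}$) the positive roots are $\varepsilon_{\overline i}\pm\varepsilon_{\overline j}$ ($1\le j<i\le n$), $\rho=(n-1,n-2,\dots,0)$ is their half sum, and $W$ is the group of signed permutations of the coordinates with an even number of sign changes, with length $l$. The $q$-partition function is defined by $\prod_{\alpha\in R^+}\frac1{1-qx^\alpha}=\sum_\beta\mathcal P_q(\beta)x^\beta$, where $R^+$ is the set of positive roots ($\mathcal P_q(\beta)=0$ if $\beta$ is not a nonnegative integral combination of positive roots), and $K_{\lambda,\mu}(q)=\sum_{\sigma\in W}(-1)^{l(\sigma)}\mathcal P_q(\sigma(\lambda+\rho)-(\mu+\rho))$.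
   Formalization: Taken for n at least 2; the formulas for K_{(2,1),(1)} and K_{(1,1),∅} are asserted only for n≥3 and that for K_{(1,1,1),(1)} only for n≥4, since at n=2, 2 and 3 respectively the true value is q while the printed formula gives 2q. *)

(* Defs.v *)
From HB Require Import structures.
From mathcomp Require Import all_boot all_order all_algebra all_fingroup.

Set Implicit Arguments.
Unset Strict Implicit.
Unset Printing Implicit Defensive.

Import Order.TTheory GRing.Theory Num.Theory.
Local Open Scope ring_scope.

(* Weights are integer row vectors.  Coordinates are stored in the order       *)
(* (b_nbar, ..., b_1bar): the index k : 'I_n stands for the barred index n - k, *)
(* so that eps 0 is epsilon_nbar, and j < i for barred indices is reversed.     *)
Definition eps n (k : 'I_n) : 'rV[int]_n := delta_mx 0 k.

Definition wt n (la : seq nat) : 'rV[int]_n := \row_k (nth 0%N la k)%:Z.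

Definition rho n : 'rV[int]_n := \row_k (n.-1 - k)%N%:Z.

Definition dotv n (u v : 'rV[int]_n) : int := (u *m v^T) 0 0.

(* Indices of the positive roots: ((i, j), s) with i < j stands for             *)
(* eps i - eps j when s = true and for eps i + eps j when s = false.            *)
Definition posroot n := {a : 'I_n * 'I_n * bool | (a.1.1 < a.1.2)%N}.

Definition root_vec n (a : posroot n) : 'rV[int]_n :=
  let: (i, j, s) := val a in eps i + (-1) ^+ s *: eps j.

(* eps k - eps (k+1), and the sum of the last two basis vectors. *)
Definition simple_root n (a : posroot n) : bool :=
  let: (i, j, s) := val a in
  (j == i.+1 :> nat) && (s || (j.+1 == n)).

(* Any expression of b as a sum of positive roots has each multiplicity at      *)
(* most (rho, b), because (rho, a) >= 1 for every positive root a.              *)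
Definition height n (b : 'rV[int]_n) : nat := `|dotv (rho n) b|%N.

(* The coefficient of x^b in the product over the positive roots a of           *)
(* 1 / (1 - q x^a) = sum_k q^k x^(k a), with q = 'X.  The bound on the          *)
(* multiplicities loses no term (see root_mult_le_height), and                  *)
(* qpartition_generating below is the generating function identity.             *)
Definition qpartition n (b : 'rV[int]_n) : {poly int} :=
  \sum_(m : {ffun posroot n -> 'I_(height b).+1}
          | \sum_a root_vec a *+ m a == b) 'X^(\sum_a m a)%N.

(* Signed permutations: (s, E) maps eps i to eps (s i), with a minus sign when  *)
(* i \in E.  Linear maps act on row vectors by right multiplication.            *)
Definition sperm n := ({perm 'I_n} * {set 'I_n})%type.

Definition sperm_mx n (w : sperm n) : 'M[int]_n :=
  \matrix_(i, j) ((-1) ^+ (i \in w.2) * (w.1 i == j)%:R).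

Definition weylD n (w : sperm n) : bool := ~~ odd #|w.2|.

(* v |-> v - (v, a) a; all roots have squared length 2. *)
Definition refl_mx n (a : posroot n) : 'M[int]_n :=
  1%:M - (root_vec a)^T *m root_vec a.

Definition has_word n (w : sperm n) (k : nat) : bool :=
  [exists t : k.-tuple (posroot n),
     all (@simple_root n) t
     && (sperm_mx w == \big[mulmx/1%:M]_(a <- t) refl_mx a)].

(* The least length of a word in the simple reflections representing w; minimal *)
(* words are shorter than the number of signed permutations, since their        *)
(* partial products are pairwise distinct.                                      *)
Definition weyl_length n (w : sperm n) : nat :=
  find (has_word w) (iota 0 #|{: sperm n}|).

Definition kostka_foulkesD n (la mu : seq nat) : {poly int} :=
  \sum_(w : sperm n | weylD w)
     (-1) ^+ weyl_length w
     * qpartition ((wt n la + rho n) *m sperm_mx w - (wt n mu + rho n)).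

Section GeneratingFunction.
Variables (I : finType) (V : zmodType) (v : I -> V) (h : V -> int).
Hypothesis hB : {morph h : x y / x - y}.
Hypothesis h_ge1 : forall i, 1 <= h (v i).

Let h0 : h 0 = 0.
Proof. by rewrite -(subrr 0) hB subrr. Qed.

Let hN : {morph h : x / - x}.
Proof. by move=> x; rewrite -sub0r hB h0 sub0r. Qed.

Let hD : {morph h : x y / x + y}.
Proof. by move=> x y; rewrite -{1}(opprK y) hB hN opprK. Qed.

Lemma multiplicity_le (m : I -> nat) i : (m i <= `|h (\sum_j v j *+ m j)|)%N.
Proof.
have hM x k : h (x *+ k) = h x *+ k.
  by elim: k => [|k IHk]; rewrite ?mulr0n ?h0 // !mulrS hD IHk.
rewrite (big_morph h hD h0) -lez_nat.
under eq_bigr do rewrite hM.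
have h_ge0 j : 0 <= h (v j) *+ m j by rewrite mulrn_wge0 // (le_trans _ (h_ge1 j)).
rewrite gez0_abs ?sumr_ge0 // (bigD1 i) //=.
apply: le_trans (_ : h (v i) *+ m i <= _); last by rewrite lerDl sumr_ge0.
by rewrite -[X in X <= _]natz lerMn2r h_ge1 orbT.
Qed.

Let P (b : V) : {poly int} :=
  \sum_(m : {ffun I -> 'I_(`|h b|).+1} | \sum_i v i *+ m i == b) 'X^(\sum_i m i)%N.

Let shiftP (A : {set I}) b :
  'X^(#|A|) * P (b - \sum_(i in A) v i)
  = \sum_(f : {ffun I -> 'I_(`|h b|).+1} | (\sum_i v i *+ f i == b)
         && [forall i in A, (0 < f i)%N]) 'X^(\sum_i f i)%N.
Proof.
set c := b - _.
pose up (m : {ffun I -> 'I_(`|h c|).+1}) : {ffun I -> 'I_(`|h b|).+1} :=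
  [ffun i => inord (m i + (i \in A))].
pose dn (f : {ffun I -> 'I_(`|h b|).+1}) : {ffun I -> 'I_(`|h c|).+1} :=
  [ffun i => inord (f i - (i \in A))].
have sumA : \sum_i v i *+ (i \in A) = \sum_(i in A) v i.
  by rewrite [RHS]big_mkcond; apply: eq_bigr => i _; case: (i \in A).
have upE (m : {ffun I -> 'I_(`|h c|).+1}) : \sum_i v i *+ m i = c -> forall i, up m i = (m i + (i \in A))%N :> nat.
  move=> mc i; rewrite ffunE inordK // ltnS.
  have := multiplicity_le (fun i => (m i + (i \in A))%N) i.
  under eq_bigr do rewrite mulrnDr.
  by rewrite big_split /= mc sumA subrK.
have dnS (f : I -> nat) :
    \sum_i v i *+ f i = b -> (forall i, i \in A -> (0 < f i)%N) ->
    \sum_i v i *+ (f i - (i \in A))%N = c.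
  move=> fb fA; rewrite /c -fb -sumA -sumrB; apply: eq_bigr => i _.
  by rewrite mulrnBr //; case: (boolP (i \in A)) => // /fA.
have dnE (f : {ffun I -> 'I_(`|h b|).+1}) : \sum_i v i *+ f i = b -> (forall i, i \in A -> (0 < f i)%N) ->
    forall i, dn f i = (f i - (i \in A))%N :> nat.
  move=> fb fA i; rewrite ffunE inordK // ltnS.
  by have := multiplicity_le (fun i => (f i - (i \in A))%N) i; rewrite dnS.
rewrite (reindex_onto up dn) /=; last first.
  move=> f /andP[/eqP fb /forall_inP fA]; apply/ffunP=> i; apply: val_inj.
  rewrite /= ffunE dnE // subnK ?inord_val //.
  by case: (boolP (i \in A)) => // /fA.
rewrite /P big_distrr /=; apply: eq_big => [m|m /eqP mc]; last first.
  rewrite -exprD; congr ('X^_).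
  under [RHS]eq_bigr do rewrite upE //.
  rewrite big_split /= [RHS]addnC; congr (_ + _)%N.
  by rewrite -sum1_card big_mkcond; apply: eq_bigr => i _; case: (i \in A).
apply/eqP/andP => [mc|[/andP[/eqP fb /forall_inP fA] /eqP dm]].
  have ub : \sum_i v i *+ up m i = b.
    under eq_bigr do rewrite upE // mulrnDr.
    by rewrite big_split /= mc sumA subrK.
  have uA i : i \in A -> (0 < up m i)%N by move=> iA; rewrite upE // iA addn1.
  split; first by rewrite ub eqxx; apply/forall_inP.
  by apply/eqP/ffunP => i; apply: val_inj; rewrite /= dnE // upE // addnK.
apply: (etrans _ (dnS _ fb fA)); apply: eq_bigr => i _.
by rewrite -(dnE _ fb fA) dm.
Qed.

Lemma generating_identity b :
  \sum_(A : {set I}) (- 'X) ^+ #|A| * P (b - \sum_(i in A) v i) = (b == 0)%:R.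
Proof.
have signs (f : {ffun I -> 'I_(`|h b|).+1}) :
    \sum_(A : {set I} | [forall i in A, (0 < f i)%N]) (-1) ^+ #|A|
    = (f == [ffun=> ord0])%:R :> {poly int}.
  transitivity (\prod_i (- (0 < f i)%N%:R + 1) : {poly int}).
    rewrite bigA_distr [LHS]big_mkcond /=; apply: eq_bigr => A _.
    rewrite -big_mkcond /=; case: ifPn => [/forall_inP fA|].
      by rewrite -prodr_const; apply: eq_bigr => i /fA ->.
    rewrite negb_forall_in => /exists_inP[i iA /negbTE fi].
    by rewrite (bigD1 i) //= fi oppr0 mul0r.
  case: eqP => [->|/eqP fn0].
    by rewrite big1 // => i _; rewrite ffunE oppr0 add0r.
  have [i fi] : exists i, (0 < f i)%N.
    apply/existsP; apply: contraR fn0 => /existsPn f0.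
    apply/eqP/ffunP => i; apply: val_inj; rewrite ffunE /=.
    by apply/eqP; rewrite -leqn0 leqNgt f0.
  by rewrite (bigD1 i) //= fi addNr mul0r.
under eq_bigr => A _ do
  rewrite exprNn -mulrA shiftP big_mkcondr /= big_distrr /=.
rewrite exchange_big /=.
transitivity (\sum_(f : {ffun I -> 'I_(`|h b|).+1} | \sum_i v i *+ f i == b)
    (f == [ffun=> ord0])%:R * 'X^(\sum_i f i)%N : {poly int}).
  apply: eq_bigr => f _; rewrite -signs big_distrl /= [RHS]big_mkcond /=.
  by apply: eq_bigr => A _; case: ifP => // _; rewrite mulr0.
rewrite big_mkcond (bigD1 [ffun=> ord0]) //=.
set r := (X in _ + X); have -> : r = 0.
  by rewrite /r; apply: big1 => f fn0; rewrite (negbTE fn0) mul0r if_same.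
rewrite addr0 {r} eqxx mul1r !big1 ?expr0 => [|i _|i _].
- by rewrite eq_sym; case: eqP.
- by rewrite ffunE.
- by rewrite ffunE mulr0n.
Qed.
End GeneratingFunction.

Lemma dotvBr n (u : 'rV[int]_n) : {morph dotv u : x y / x - y}.
Proof. by move=> x y; rewrite /dotv linearB /= mulmxBr !mxE. Qed.

Lemma dotv_rho_ge1 n (a : posroot n) : 1 <= dotv (rho n) (root_vec a).
Proof.
case: a => [[[i j] s] /= ij]; rewrite /dotv /root_vec /= /eps.
rewrite linearD linearZ /= !trmx_delta mulmxDr -scalemxAr -!colE !mxE.
have jn := ltn_ord j; case: s; rewrite ?expr1 ?expr0 ?mulN1r ?mul1r.
  rewrite lerBrDr -PoszD lez_nat add1n.
  by rewrite ltn_sub2l // -ltnS prednK // (leq_ltn_trans _ jn).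
rewrite -PoszD lez_nat addn_gt0 subn_gt0.
by rewrite (leq_trans ij) // -ltnS prednK // (leq_ltn_trans _ jn).
Qed.

Lemma root_mult_le_height n (b : 'rV[int]_n) (m : posroot n -> nat) :
  \sum_a root_vec a *+ m a = b -> forall a, (m a <= height b)%N.
Proof.
by move=> <- a; apply: (multiplicity_le (@dotvBr _ _) (@dotv_rho_ge1 n)).
Qed.

(* The coefficient of x^b in                                                    *)
(* prod_a (1 - q x^a) * sum_g qpartition g x^g = 1.                             *)
Lemma qpartition_generating n (b : 'rV[int]_n) :
  \sum_(A : {set posroot n})
     (- 'X) ^+ #|A| * qpartition (b - \sum_(a in A) root_vec a) = (b == 0)%:R.
Proof. exact: (generating_identity (@dotvBr _ _) (@dotv_rho_ge1 n)). Qed.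

(* Main.v *)
From HB Require Import structures.
Require Import Defs.
From mathcomp Require Import all_boot all_order all_algebra all_fingroup.
From mathcomp Require Import zify ring.

Set Implicit Arguments.
Unset Strict Implicit.
Unset Printing Implicit Defensive.

Import Order.TTheory GRing.Theory Num.Theory.
Local Open Scope ring_scope.

(* On even signed permutations the sign of [w] is that of its underlying
   permutation.  Splitting off the positive roots that involve the first
   coordinate expresses the q-partition function of D_(m+1) by that of D_m.  For
   the weights of the theorem the first coordinate of [w (la + rho) - (mu + rho)]
   is negative unless [w] sends one of at most two coordinates to the first one,
   and then it is 0, 1 or 2, so that at most two such roots occur.  The sums over
   the weights [+- eps j] that appear are invariant under the Weyl group and can
   be moved next to [la]; since the alternating sum is antisymmetric in
   [la + rho], only few terms survive (Pieri rules for the vector representation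
   V, V * V and Sym^2 V).  This yields, with K_n in rank n,
     K_(n+1)[(2),0]   = q^2 (K_n[(2),0] + 1),
     K_(n+1)[(1,1),0] = q A_n - K_n[(2),0],  A_n = K_n[(2),0] + K_n[(1,1),0] + 1
   (with an extra term in A_2), and the other values reduce to these.  The
   vanishing values follow from the parity of the coordinate sum of a root. *)

(** * Signs of signed permutations *)

Section SignedPermutations.
Variable n : nat.
Implicit Types (w u : sperm n) (g : 'rV[int]_n) (x : 'I_n * bool).

(** Matrices act on row vectors from the right, so [w] acts first and the sign of [u] is read at the
    image [w.1 i]. *)
Definition spmul w u : sperm n :=
  ((w.1 * u.1)%g, [set i | (i \in w.2) (+) (w.1 i \in u.2)]).

Lemma sperm_mxM w u : sperm_mx (spmul w u) = sperm_mx w *m sperm_mx u.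
Proof.
apply/matrixP => i j; rewrite !mxE (bigD1 (w.1 i)) //= big1 => [|k kn].
  by rewrite !mxE inE permM eqxx mulr1 addr0 signr_addb mulrA.
by rewrite !mxE [w.1 i == k]eq_sym (negPf kn) mulr0 mul0r.
Qed.

Definition sp1 : sperm n := (1%g, set0).

Lemma sperm_mx1 : sperm_mx sp1 = 1%:M.
Proof. by apply/matrixP => i j; rewrite !mxE inE perm1 mul1r. Qed.

Lemma sperm_mx_inj : injective (@sperm_mx n).
Proof.
move=> [s E] [t F] /matrixP est.
have eqst i : s i = t i.
  have := est i (s i); rewrite !mxE eqxx mulr1.
  case: eqP => [//|_] /eqP.
  by rewrite mulr0 signr_eq0.
congr (_, _); first exact/permP.
apply/setP => i; have := est i (s i); rewrite !mxE eqst eqxx !mulr1 /=.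
by case: (i \in E); case: (i \in F).
Qed.

Lemma mulmx_sperm g w j :
  (g *m sperm_mx w) 0 (w.1 j) = (-1) ^+ (j \in w.2) * g 0 j.
Proof.
rewrite mxE (bigD1 j) //= big1 => [|k kn]; first by rewrite mxE eqxx mulr1 addr0 mulrC.
by rewrite mxE (inj_eq perm_inj) (negPf kn) !mulr0.
Qed.

(* The weights [+- eps i] of the vector representation. *)
Definition sv x : 'rV[int]_n := (-1) ^+ x.2 *: eps x.1.

Definition sact w x := (w.1 x.1, x.2 (+) (x.1 \in w.2)).

Lemma svE x j : sv x 0 j = (-1) ^+ x.2 * (j == x.1)%:R.
Proof. by rewrite !mxE eqxx. Qed.

Lemma sv_sperm w x : sv x *m sperm_mx w = sv (sact w x).
Proof.
apply/rowP => j; rewrite -(permKV w.1 j) mulmx_sperm !svE /= (inj_eq perm_inj).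
by case: eqP => [->|_]; rewrite ?mulr0 // !mulr1 signr_addb mulrC.
Qed.

Lemma sact_inj w : injective (sact w).
Proof.
by move=> [i s] [j t] [/perm_inj ->] /addIb ->.
Qed.

Definition srefl (i j : 'I_n) (s : bool) : sperm n :=
  (tperm i j, if s then set0 else [set i; j]).

Lemma refl_mxE (a : posroot n) :
  refl_mx a = sperm_mx (srefl (val a).1.1 (val a).1.2 (val a).2).
Proof.
case: a => [[[i j] s] /= ij]; rewrite /refl_mx /root_vec /= /eps.
have nij : (i == j) = false by apply/negbTE; rewrite neq_ltn ij.
apply/matrixP => k l; rewrite !mxE big_ord1 !mxE /=.
have tE : (tperm i j k == l) = if k == i then j == l else if k == j then i == l else k == l.
  by case: tpermP => [->|->|/eqP/negPf-> /eqP/negPf->]; rewrite ?eqxx // [j == i]eq_sym nij.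
rewrite tE ![l == _]eq_sym.
have [->|nik] := eqVneq k i.
  have [<-|nil] := eqVneq i l; rewrite ?nij ?[j == i]eq_sym ?nij;
  case: s; rewrite ?inE ?eqxx /= ?expr0 ?expr1; try ring;
  by case: eqP => _ /=; ring.
have [->|njk] := eqVneq k j.
  have [<-|njl] := eqVneq j l; rewrite ?nij;
  case: s; rewrite ?inE ?eqxx ?orbT /= ?expr0 ?expr1; try ring;
  by case: eqP => _ /=; ring.
by case: s; rewrite ?inE ?(negPf nik) ?(negPf njk) /= ?expr0 ?expr1; ring.
Qed.

Lemma det_sperm w : \det (sperm_mx w) = (-1) ^+ #|w.2| * (-1) ^+ w.1.
Proof.
have -> : sperm_mx w = diag_mx (\row_i (-1) ^+ (i \in w.2)) *m perm_mx w.1.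
  by apply/matrixP => i j; rewrite mul_diag_mx !mxE.
rewrite det_mulmx det_perm det_diag; congr (_ * _).
under eq_bigr do rewrite mxE.
rewrite prodrXr; congr (_ ^+ _); rewrite -sum1_card [RHS]big_mkcond.
by apply: eq_bigr => i _; case: (i \in w.2).
Qed.

Lemma det_weylD w : weylD w -> \det (sperm_mx w) = (-1) ^+ w.1.
Proof. by rewrite /weylD det_sperm -signr_odd => /negPf->; rewrite mul1r. Qed.

(** The determinant and the sign of the permutation are both multiplicative, and their quotient is
    the parity of the number of sign changes. *)
Lemma weylD_spmul w u : weylD (spmul w u) = (weylD w == weylD u).
Proof.
have := congr1 determinant (sperm_mxM w u); rewrite det_mulmx !det_sperm /= odd_permM.
rewrite signr_addb -!(signr_odd _ #|_|) /weylD.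
by do ![case: (odd #|_|)]; case: (odd_perm w.1); case: (odd_perm u.1).
Qed.

(** * Generation of the even signed permutations by simple reflections *)

Definition simple_gen (M : 'M[int]_n) : Prop :=
  exists2 t : seq (posroot n), all (@simple_root n) t
    & M = \big[mulmx/1%:M]_(a <- t) refl_mx a.

Lemma simple_genM A B : simple_gen A -> simple_gen B -> simple_gen (A *m B).
Proof.
move=> [t st ->] [u su ->]; exists (t ++ u); first by rewrite all_cat st.
elim: {st} t => [|a t IHt] /=; first by rewrite big_nil mul1mx.
by rewrite !big_cons -mulmxA IHt.
Qed.

Lemma simple_gen_spmul w u : simple_gen (sperm_mx w) -> simple_gen (sperm_mx u) ->
  simple_gen (sperm_mx (spmul w u)).
Proof. by rewrite sperm_mxM; apply: simple_genM. Qed.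

Lemma simple_gen1 : simple_gen (sperm_mx sp1).
Proof. by exists [::] => //; rewrite big_nil sperm_mx1. Qed.

Lemma simple_gen_srefl (i j : 'I_n) s :
  j = i.+1 :> nat -> s || (j.+1 == n) -> simple_gen (sperm_mx (srefl i j s)).
Proof.
move=> ji sj; have ij : (i < j)%N by rewrite ji.
exists [:: exist _ ((i, j), s) ij : posroot n].
  by rewrite /= andbT /simple_root /= ji eqxx -ji.
by rewrite big_cons big_nil mulmx1 refl_mxE.
Qed.

Lemma spmul_perm (s t : {perm 'I_n}) : spmul (s, set0) (t, set0) = ((s * t)%g, set0).
Proof. by congr (_, _); apply/setP => i; rewrite !inE. Qed.

(** Induction on the distance: the transposition of [i] and [j] is that of [i] and [k = j - 1],
    conjugated by the simple transposition of [k] and [j]. *)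
Lemma simple_gen_tperm (i j : 'I_n) : (i < j)%N -> simple_gen (sperm_mx (srefl i j true)).
Proof.
move: {2}(j - i)%N (erefl (j - i)%N) => d; elim: d j => [|d IHd] j; first by lia.
move=> dE ij; have [ji|ji] := eqVneq (j : nat) i.+1; first exact: simple_gen_srefl.
have kn : (j.-1 < n)%N by have := ltn_ord j; lia.
pose k := Ordinal kn.
have kj : simple_gen (sperm_mx (srefl k j true)).
  by apply: simple_gen_srefl => //=; lia.
have ik : simple_gen (sperm_mx (srefl i k true)) by apply: IHd => /=; lia.
have := simple_gen_spmul (simple_gen_spmul kj ik) kj.
rewrite /srefl !spmul_perm -mulgA -[X in (X * _)%g]tpermV -conjgE tpermJ tpermL tpermD //.
  by rewrite -val_eqE /=; lia.
by rewrite -val_eqE /=; lia.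
Qed.

Lemma simple_gen_perm (s : {perm 'I_n}) : simple_gen (sperm_mx (s, set0)).
Proof.
case: (prod_tpermP s) => t -> {s}; elim: t => [|[i j] t IHt] /=.
  by rewrite big_nil => _; exact: simple_gen1.
rewrite big_cons => /andP[nij /IHt gt]; rewrite -spmul_perm.
apply: simple_gen_spmul gt; move: nij; rewrite /dpair /= neq_ltn.
by case/orP => ij; [|rewrite tpermC]; exact: simple_gen_tperm.
Qed.

(** The last simple reflection times the transposition of the last two coordinates only changes
    their signs; conjugating by a permutation that moves [i] and [j] there gives the general
    case. *)
Lemma simple_gen_flip2 (i j : 'I_n) : i != j -> simple_gen (sperm_mx (1%g, [set i; j])).
Proof.
move=> nij; have [pn qn] : (n.-2 < n)%N /\ (n.-1 < n)%N.
  by have := ltn_ord i; have := ltn_ord j; move: nij; rewrite -val_eqE /=; lia.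
pose p := Ordinal pn; pose q := Ordinal qn.
have pq : p != q.
  by have := ltn_ord i; have := ltn_ord j; move: nij; rewrite -!val_eqE /=; lia.
have gpq : simple_gen (sperm_mx (1%g, [set p; q])).
  have g1 : simple_gen (sperm_mx (srefl p q false)).
    by apply: simple_gen_srefl => /=; move: pq; rewrite -val_eqE /=; lia.
  have := simple_gen_spmul g1 (simple_gen_perm (tperm p q)).
  congr (simple_gen (sperm_mx _)); congr (_, _); first exact: tperm2.
  by apply/setP => k; rewrite !inE addbF.
(* The first factor sends [i] to [p]; the second moves the current image of [j] to [q] and fixes
   [p]. *)
pose s : {perm 'I_n} := (tperm i p * tperm (tperm i p j) q)%g.
have si : s i = p.
  rewrite permM tpermL; apply: tpermD; last by rewrite eq_sym.
  by rewrite -[X in _ != X](tpermL i p) (inj_eq perm_inj) eq_sym.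
have sj : s j = q by rewrite permM tpermL.
have := simple_gen_spmul (simple_gen_spmul (simple_gen_perm s) gpq) (simple_gen_perm s^-1%g).
congr (simple_gen (sperm_mx _)); congr (_, _); first by rewrite /= mulg1 mulgV.
by apply/setP => k; rewrite !inE -si -sj !(inj_eq perm_inj) addbF.
Qed.

(** Sign changes are removed two at a time. *)
Lemma simple_gen_flip (E : {set 'I_n}) : ~~ odd #|E| -> simple_gen (sperm_mx (1%g, E)).
Proof.
move: {2}#|E| (leqnn #|E|) => d; elim: d E => [|d IHd] E.
  by rewrite leqn0 cards_eq0 => /eqP-> _; exact: simple_gen1.
move=> dE oE; have [->|[i iE]] := set_0Vmem E; first exact: simple_gen1.
have cE := cardsD1 i E; rewrite iE in cE.
have [E0|[j jE]] := set_0Vmem (E :\ i); first by rewrite cE E0 cards0 in oE.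
have cE' := cardsD1 j (E :\ i); rewrite jE in cE'.
have gE : simple_gen (sperm_mx (1%g, E :\ i :\ j)).
  by apply: IHd; move: dE oE; rewrite cE cE' ?oddD /=; lia.
move: (jE); rewrite !inE eq_sym => /andP[nij jE'].
have := simple_gen_spmul (simple_gen_flip2 nij) gE.
congr (simple_gen (sperm_mx _)); congr (_, _); first by rewrite /= mulg1.
apply/setP => k; rewrite !inE perm1.
have [->|ki] := eqVneq k i; first by rewrite iE andbF.
by have [->|kj] := eqVneq k j; rewrite ?jE' // andbF.
Qed.

Lemma weylD_simple_gen w : weylD w -> simple_gen (sperm_mx w).
Proof.
case: w => s E /simple_gen_flip gE.
have := simple_gen_spmul gE (simple_gen_perm s).
congr (simple_gen (sperm_mx _)); congr (_, _); first by rewrite /= mul1g.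
by apply/setP => k; rewrite !inE addbF.
Qed.

Lemma det_refl_mx (a : posroot n) : \det (refl_mx a) = -1.
Proof.
case: a => [[[i j] s] ij]; rewrite refl_mxE det_sperm /= odd_tperm.
have nij : i != j by rewrite neq_ltn (ij : (i < j)%N).
by rewrite nij; case: s {ij} => /=; rewrite ?cards0 ?cards2 ?nij ?expr1 ?expr0 ?expr2; ring.
Qed.

(** Each reflection has determinant -1, so the determinant fixes the parity of the length of every
    word. *)
Lemma has_word_sign w k : has_word w k -> \det (sperm_mx w) = (-1) ^+ k.
Proof.
case/existsP => t /andP[_ /eqP->]; rewrite -[in RHS](size_tuple t).
elim: {t} (t : seq _) => [|a t IHt] /=; first by rewrite big_nil det1.
by rewrite big_cons det_mulmx det_refl_mx IHt exprS.
Qed.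

Lemma has_wordP w k : reflect
  (exists t : seq (posroot n), [/\ size t = k, all (@simple_root n) t
     & sperm_mx w = \big[mulmx/1%:M]_(a <- t) refl_mx a]) (has_word w k).
Proof.
apply: (iffP existsP) => [[t /andP[st /eqP wt]]|[t [zt st wt]]].
  by exists t; rewrite size_tuple.
by exists (tcast zt (in_tuple t)); rewrite !val_tcast st wt /=.
Qed.

(* A shortest path from the identity in this graph repeats no vertex, which bounds
   the search in [weyl_length]. *)
Definition cayley : rel (sperm n) :=
  [rel w u | [exists a, simple_root a && (sperm_mx u == sperm_mx w *m refl_mx a)]].

Lemma cayley_connect (t : seq (posroot n)) w u : all (@simple_root n) t ->
  sperm_mx u = sperm_mx w *m \big[mulmx/1%:M]_(a <- t) refl_mx a ->
  connect cayley w u.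
Proof.
elim: t w => [|a t IHt] w /=.
  by rewrite big_nil mulmx1 => _ /sperm_mx_inj->.
move=> /andP[sa st]; rewrite big_cons mulmxA => uE.
pose v := spmul w (srefl (val a).1.1 (val a).1.2 (val a).2).
have vE : sperm_mx v = sperm_mx w *m refl_mx a by rewrite sperm_mxM refl_mxE.
apply: (connect_trans (connect1 _) (IHt v st _)); last by rewrite vE.
by apply/existsP; exists a; rewrite sa vE /=.
Qed.

Lemma cayley_path w p : path cayley w p -> exists t : seq (posroot n),
  [/\ size t = size p, all (@simple_root n) t &
     sperm_mx (last w p) = sperm_mx w *m \big[mulmx/1%:M]_(a <- t) refl_mx a].
Proof.
elim: p w => [|v p IHp] w /=; first by exists [::]; rewrite big_nil mulmx1.
move=> /andP[/existsP[a /andP[sa /eqP vE]] /IHp[t [zt st uE]]].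
by exists (a :: t); rewrite /= zt sa st uE vE big_cons mulmxA.
Qed.

(** [find] returns the length of an actual word once some word lies below the search bound; the sign
    is then read off the determinant. *)
Lemma weyl_length_sign w : weylD w -> (-1) ^+ weyl_length w = (-1) ^+ w.1 :> {poly int}.
Proof.
move=> Dw; have [t st wt] := weylD_simple_gen Dw.
have /connectP[p0 p0_path wl] : connect cayley sp1 w.
  by apply: (cayley_connect st); rewrite sperm_mx1 mul1mx.
case: (shortenP p0_path) wl => p p_path p_uniq _ wl {p0 p0_path}.
have [u [zu su]] := cayley_path p_path.
rewrite -wl sperm_mx1 mul1mx => wu.
(* The vertices [sp1 :: p] are distinct, so the path has fewer steps than there are signed
   permutations. *)
have ltu : (size u < #|{: sperm n}|)%N.
  by rewrite zu; have := max_card (mem (sp1 :: p)); rewrite (card_uniqP p_uniq).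
have hu : has (has_word w) (iota 0 #|{: sperm n}|).
  by apply/hasP; exists (size u); [rewrite mem_iota | apply/has_wordP; exists u].
have := nth_find 0%N hu; rewrite -/(weyl_length w) nth_iota -?has_find; last first.
  by rewrite -[X in (_ < X)%N](size_iota 0) -has_find.
rewrite add0n => /has_word_sign; rewrite (det_weylD Dw) => e.
have /(congr1 (fun x : int => x%:~R : {poly int})) := e.
by rewrite !rmorphXn /= rmorphN rmorph1.
Qed.
End SignedPermutations.

(** * The q-partition function in terms of lower rank *)

(** The bound [N] on the multiplicities is arbitrary, so that weights of different heights and ranks
    can share one bound. *)
Definition qpart n N (b : 'rV[int]_n) : {poly int} :=
  \sum_(m : {ffun posroot n -> 'I_N.+1} | \sum_a root_vec a *+ m a == b)
     'X^(\sum_a m a)%N.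

Lemma qpartitionE n N (b : 'rV[int]_n) : (height b <= N)%N -> qpartition b = qpart N b.
Proof.
rewrite -ltnS => bN; rewrite /qpart.
pose up (m : {ffun posroot n -> 'I_(height b).+1}) : {ffun posroot n -> 'I_N.+1} :=
  [ffun a => widen_ord bN (m a)].
pose dn (m : {ffun posroot n -> 'I_N.+1}) : {ffun posroot n -> 'I_(height b).+1} :=
  [ffun a => inord (m a)].
rewrite (reindex_onto up dn) /=; last first.
  move=> m /eqP mb; apply/ffunP => a; apply: val_inj; rewrite !ffunE /= inordK //.
  by rewrite ltnS (root_mult_le_height mb).
have upE m a : up m a = m a :> nat by rewrite ffunE.
apply: eq_big => [m|m _]; last by under [in RHS]eq_bigr do rewrite upE.
under [in RHS]eq_bigr do rewrite upE.
rewrite (_ : dn _ = m) ?eqxx ?andbT //.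
by apply/ffunP => a; apply: val_inj; rewrite !ffunE /= inord_val.
Qed.

Lemma rV_eq_split m (u v : 'rV[int]_m.+1) :
  (u == v) = (u 0 ord0 == v 0 ord0) && (col' ord0 u == col' ord0 v).
Proof.
apply/eqP/andP => [->|[/eqP uv0 /eqP /rowP uvS]]; first by rewrite !eqxx.
apply/rowP => k; case: (unliftP ord0 k) => [j|] ->; last exact: uv0.
by have := uvS j; rewrite !mxE.
Qed.

Lemma big_fibers (V : nmodType) (Y C : finType) (P : pred C) (h : Y -> C) k (F : C -> V) :
  (forall y, P (h y)) -> (forall c, P c -> #|[pred y | h y == c]| = k) ->
  \sum_y F (h y) = (\sum_(c | P c) F c) *+ k.
Proof.
move=> Ph cardh; rewrite (partition_big h P) // -sumrMnl; apply: eq_bigr => c Pc.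
rewrite -(cardh c Pc) -sumr_const; apply: eq_big => [y|y /eqP->] //.
Qed.

(** * Multisets with at most two elements as multiplicity functions *)

Section Multisets.
Variable T : finType.
Implicit Types (x y z : T).

Lemma sum_mulrb_delta (V : nmodType) (f : T -> V) x : \sum_z f z *+ (x == z) = f x.
Proof.
by rewrite (bigD1 x) //= eqxx big1 ?addr0 // => z zx; rewrite eq_sym (negPf zx).
Qed.

Lemma sumn_delta x : (\sum_z (x == z) = 1)%N.
Proof.
by rewrite (bigD1 x) //= eqxx big1 // => z zx; rewrite eq_sym (negPf zx).
Qed.

Lemma sum_succ_split (f : T -> nat) k : (\sum_z f z = k.+1)%N ->
  exists x, exists2 f', (\sum_z f' z = k)%N & forall z, f z = ((x == z) + f' z)%N.
Proof.
move=> fk; have [x fx] : exists x, (0 < f x)%N.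
  apply/existsP; apply: contra_eqT fk => /existsPn f0.
  by rewrite big1 // => z _; apply/eqP; rewrite -leqn0 leqNgt f0.
have fE z : f z = ((x == z) + (f z - (x == z)))%N by rewrite subnKC //; case: eqP => // <-.
exists x, (fun z => f z - (x == z))%N => //; apply/eqP; rewrite -eqSS -fk.
under [in X in _ == X]eq_bigr do rewrite fE.
by rewrite big_split /= sumn_delta.
Qed.

Lemma sum_eq0 (f : T -> nat) : (\sum_z f z = 0)%N -> forall z, f z = 0%N.
Proof. by move/eqP; rewrite sum_nat_eq0 => /forallP f0 z; apply/eqP; apply: (f0 z). Qed.

Variables (N : nat) (V : nmodType) (F : {ffun T -> 'I_N.+1} -> V).
Implicit Types (c : {ffun T -> 'I_N.+1}).

(** The multisets {x} and, below, {x, y}. The values of [inord] are the intended ones once [N] is at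
    least 1, respectively 2. *)
Definition mult1 x : {ffun T -> 'I_N.+1} := [ffun z => inord (x == z)].
Definition mult2 x y : {ffun T -> 'I_N.+1} := [ffun z => inord ((x == z) + (y == z))].

Lemma mult1E x z : (0 < N)%N -> mult1 x z = (x == z) :> nat.
Proof. by move=> N0; rewrite ffunE inordK // ltnS (leq_trans (leq_b1 _)). Qed.

Lemma mult2E x y z : (1 < N)%N -> mult2 x y z = ((x == z) + (y == z))%N :> nat.
Proof.
by move=> N1; rewrite ffunE inordK // ltnS (leq_trans _ N1) // (leq_add (leq_b1 _) (leq_b1 _)).
Qed.

Lemma sum_mult0 : \sum_(c : {ffun T -> 'I_N.+1} | (\sum_z c z == 0)%N) F c = F [ffun=> ord0].
Proof.
rewrite (bigD1 [ffun=> ord0]) /=; last by rewrite big1 // => z _; rewrite ffunE.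
rewrite big1 ?addr0 // => c /andP[/eqP/sum_eq0 c0 /eqP[]].
by apply/ffunP => z; apply: val_inj; rewrite ffunE /= c0.
Qed.

Lemma sum_mult1 : (0 < N)%N ->
  \sum_(c : {ffun T -> 'I_N.+1} | (\sum_z c z == 1)%N) F c = \sum_x F (mult1 x).
Proof.
move=> N0; have mE x z := mult1E x z N0.
rewrite -[LHS]mulr1n; symmetry.
apply: big_fibers => [x|c /eqP/sum_succ_split[x [f /sum_eq0 f0 cE]]].
  by under eq_bigr do rewrite mE; rewrite sumn_delta.
rewrite -(card1 x); apply: eq_card => y; rewrite !inE.
apply/eqP/eqP => [mc|->]; last first.
  by apply/ffunP => z; apply: val_inj; rewrite /= mE cE f0 addn0.
have := mE y x; rewrite mc cE eqxx f0; by case: eqP.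
Qed.

(** Ordered pairs reach {x, y} twice if x and y differ and only once otherwise; the diagonal sum
    supplies the missing preimage, so all fibres have two elements. *)
Lemma sum_mult2 : (1 < N)%N ->
  (\sum_(c : {ffun T -> 'I_N.+1} | (\sum_z c z == 2)%N) F c) *+ 2
  = \sum_x \sum_y F (mult2 x y) + \sum_x F (mult2 x x).
Proof.
move=> N1; have mE x y z := mult2E x y z N1.
pose h (p : T * T + T) := match p with inl p => mult2 p.1 p.2 | inr x => mult2 x x end.
rewrite pair_bigA /=.
have -> : \sum_p F (mult2 p.1 p.2) + \sum_x F (mult2 x x) = \sum_p F (h p).
  by rewrite big_sumType.
symmetry; apply: big_fibers => [p|c].
  suff m2 x y : (\sum_z mult2 x y z == 2)%N by case: p => *; exact: m2.
  by under eq_bigr do rewrite mE; rewrite big_split /= !sumn_delta.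
case/eqP/sum_succ_split => x [f /sum_succ_split[y [f' /sum_eq0 f0 fE]] cE].
have {fE f0} -> : c = mult2 x y.
  by apply/ffunP => z; apply: val_inj; rewrite /= mE cE fE f0 addn0.
have mm u v : (mult2 u v == mult2 x y) = (u == x) && (v == y) || (u == y) && (v == x).
  apply/eqP/orP => [mc|[]/andP[/eqP-> /eqP->] //]; last first.
    by apply/ffunP => z; apply: val_inj; rewrite /= !mE addnC.
  have e z : ((u == z) + (v == z))%N = ((x == z) + (y == z))%N by rewrite -!mE mc.
  move: (e u) (e v) (e x) (e y); rewrite !eqxx ![_ == u]eq_sym ![x == v]eq_sym.
  rewrite ![y == v]eq_sym [y == x]eq_sym.
  by do ![case: eqVneq => ? /=]; subst => //=; rewrite ?eqxx; auto.
transitivity (#|[pred p | mult2 p.1 p.2 == mult2 x y]| + #|[pred u | mult2 u u == mult2 x y]|)%N.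
  by rewrite -!sum1_card big_sumType.
rewrite (eq_card (B := mem [set (x, y); (y, x)])) => [|[u v]]; last first.
  by rewrite !inE /= mm !xpair_eqE.
have -> : #|[pred u | mult2 u u == mult2 x y]| = (x == y).
  have [xy|xy] := eqVneq x y.
    by apply: etrans (card1 x); apply: eq_card => u; rewrite !inE /= mm -xy orbb andbb.
  apply: eq_card0 => u; rewrite !inE /= mm.
  by have [->|] := eqVneq u x; rewrite ?(negPf xy) // andbF.
by rewrite cards2 xpair_eqE [y == x]eq_sym andbb; case: eqP.
Qed.

End Multisets.

(** * Splitting off the positive roots that involve the first coordinate *)

Section Split.
Variable m : nat.
Implicit Types (x : 'I_m * bool) (a : posroot m) (b : 'rV[int]_m.+1).

(** These roots have first coordinate 1, and their remaining coordinates form the weight [sv x] of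
    the vector representation one rank lower. *)
Definition root_head x : posroot m.+1 :=
  exist (fun a : 'I_m.+1 * 'I_m.+1 * bool => (a.1.1 < a.1.2)%N)
    (ord0, lift ord0 x.1, x.2) isT.

Lemma lift0_lt (i j : 'I_m) : (i < j)%N -> (lift ord0 i < lift ord0 j)%N.
Proof. by []. Qed.

Definition root_tail a : posroot m.+1 :=
  exist (fun a : 'I_m.+1 * 'I_m.+1 * bool => (a.1.1 < a.1.2)%N)
    (lift ord0 (val a).1.1, lift ord0 (val a).1.2, (val a).2) (lift0_lt (valP a)).

Definition root_of_sum (y : ('I_m * bool) + posroot m) :=
  match y with inl x => root_head x | inr a => root_tail a end.

Lemma root_of_sum_bij : bijective root_of_sum.
Proof.
have inj : injective root_of_sum.
  move=> y z e; have e1 := congr1 (fun r => (val r).1.1) e.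
  have e2 := congr1 (fun r => (val r).1.2) e; have e3 := congr1 (fun r => (val r).2) e.
  case: y z {e} e1 e2 e3 => [[i s]|[[[i j] s] ij]] [[k t]|[[[k l] t] kl]] //=.
    by move=> _ /lift_inj-> ->.
  by move=> /lift_inj ik /lift_inj jl st; congr (inr _); apply: val_inj; rewrite /= ik jl st.
apply: inj_card_bij inj _.
apply: leq_trans (leq_image_card root_of_sum predT); apply/subset_leq_card/subsetP.
move=> [[[i j] s] ij] _; apply/imageP.
have [i'|] := unliftP ord0 i => [i'E|i0]; last first.
  have [j'|j0] := unliftP ord0 j => [j'E|]; last by exfalso; rewrite i0 j0 in ij.
  by exists (inl (j', s)) => //; apply: val_inj; rewrite /= i0 j'E.
have [j'|j0] := unliftP ord0 j => [j'E|]; last by exfalso; rewrite j0 in ij.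
have ij' : (i' < j')%N by move: ij; rewrite i'E j'E.
by exists (inr (exist _ (i', j', s) ij')) => //; apply: val_inj; rewrite /= i'E j'E.
Qed.

Lemma root_head0 x : root_vec (root_head x) 0 ord0 = 1.
Proof. by rewrite !mxE /= mulr0 addr0. Qed.

Lemma root_headS x : col' ord0 (root_vec (root_head x)) = sv x.
Proof.
by apply/rowP => k; rewrite !mxE /= add0r (inj_eq (@lift_inj _ _)).
Qed.

Lemma root_tail0 a : root_vec (root_tail a) 0 ord0 = 0.
Proof. by case: a => [[[i j] s] ij]; rewrite !mxE /= mulr0 addr0. Qed.

Lemma root_tailS a : col' ord0 (root_vec (root_tail a)) = root_vec a.
Proof.
by case: a => [[[i j] s] ij]; apply/rowP => k; rewrite !mxE /= !(inj_eq (@lift_inj _ _)).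
Qed.

(** [c] collects the multiplicities of the roots [root_head x]. The first coordinate of [b] forces
    their number, and what is left must be a combination of the roots of rank m. *)
Lemma qpart_split N b :
  qpart N b = \sum_(c : {ffun 'I_m * bool -> 'I_N.+1} | (\sum_x c x)%N%:Z == b 0 ord0)
    'X^(\sum_x c x)%N * qpart N (col' ord0 b - \sum_x sv x *+ c x).
Proof.
have [g rK gK] := root_of_sum_bij.
pose fT := {ffun 'I_m * bool -> 'I_N.+1}; pose fR := {ffun posroot m -> 'I_N.+1}.
pose glue (cd : fT * fR) : {ffun posroot m.+1 -> 'I_N.+1} :=
  [ffun r => match g r with inl x => cd.1 x | inr a => cd.2 a end].
have glueL cd x : glue cd (root_head x) = cd.1 x.
  by rewrite ffunE -[root_head x]/(root_of_sum (inl x)) rK.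
have glueR cd a : glue cd (root_tail a) = cd.2 a.
  by rewrite ffunE -[root_tail a]/(root_of_sum (inr a)) rK.
have sum_root (R : nmodType) (F : posroot m.+1 -> R) :
    \sum_r F r = \sum_x F (root_head x) + \sum_a F (root_tail a).
  by rewrite (reindex root_of_sum) /= ?big_sumType //; exists g => z _.
under [RHS]eq_bigr do rewrite /qpart big_distrr /=.
rewrite pair_big_dep /= /qpart (reindex glue) /=; last first.
  exists (fun f => ([ffun x => f (root_head x)], [ffun a => f (root_tail a)])).
    move=> [c d] _; congr (_, _); apply/ffunP => y; rewrite ffunE ?glueL ?glueR //.
  move=> f _; apply/ffunP => r; rewrite ffunE -{2}[r]gK.
  by case: (g r) => y; rewrite ffunE.
apply: eq_big => [[c d]|[c d] _] /=; last first.
  rewrite -exprD; congr ('X^_); rewrite (sum_root nat).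
  by congr (_ + _)%N; apply: eq_bigr => y _; rewrite ?glueL ?glueR.
rewrite rV_eq_split; congr (_ && _).
  rewrite sum_root mxE !summxE [X in _ + X]big1 => [|a _]; last first.
    by rewrite mulmxnE root_tail0 mul0rn.
  rewrite addr0 -natz natr_sum; congr (_ == _); apply: eq_bigr => x _.
  by rewrite mulmxnE root_head0 glueL.
rewrite -subr_eq0 -[RHS]subr_eq0; congr (_ == _); apply/rowP => k.
rewrite sum_root !mxE !summxE opprB addrC [RHS]addrA [RHS]addrC.
congr (_ + _); rewrite [RHS]addrC; congr (_ + _); apply: eq_bigr => y _.
  by rewrite !mulmxnE -root_headS glueL !mxE.
by rewrite !mulmxnE -root_tailS glueR !mxE.
Qed.

Lemma qpartition_head_lt0 b : b 0 ord0 < 0 -> qpartition b = 0.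
Proof.
move=> b0; rewrite (qpartitionE (leqnn _)) qpart_split big_pred0 // => c.
by apply: contraTF b0 => /eqP <-.
Qed.

Lemma qpartition_head0 b : b 0 ord0 = 0 -> qpartition b = qpartition (col' ord0 b).
Proof.
move=> b0; pose N := maxn (height b) (height (col' ord0 b)).
rewrite (@qpartitionE _ N _ (leq_maxl _ _)) [RHS](@qpartitionE _ N _ (leq_maxr _ _)).
rewrite qpart_split b0 (eq_bigl _ _ (fun c => eqz_nat _ 0)) sum_mult0.
rewrite !big1 ?expr0 ?mul1r ?subr0 // => x _; by rewrite ffunE ?mulr0n.
Qed.

Lemma qpartition_head1 b : b 0 ord0 = 1 ->
  qpartition b = 'X * \sum_x qpartition (col' ord0 b - sv x).
Proof.
(* One bound for all heights that occur, and at least 1 so that [mult1] takes its intended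
   values. *)
move=> b1; pose N := (height b + \sum_x height (col' ord0 b - sv x)).+1%N.
rewrite (@qpartitionE _ N); last by rewrite leqW // leq_addr.
rewrite qpart_split b1 (eq_bigl _ _ (fun c => eqz_nat _ 1)) sum_mult1 //.
rewrite big_distrr /=; apply: eq_bigr => x _.
under eq_bigr do rewrite mult1E //.
rewrite sumn_delta expr1; congr (_ * _).
under eq_bigr do rewrite mult1E //.
rewrite sum_mulrb_delta -qpartitionE // leqW // addnC (bigD1 x) //=.
by rewrite -addnA leq_addr.
Qed.

(* Multisets of two weights are counted by ordered pairs: twice the complete
   symmetric function h_2 is p_1 ^ 2 + p_2. *)
Lemma qpartition_head2 b : b 0 ord0 = 2 ->
  qpartition b *+ 2 = 'X^2 * (\sum_x \sum_y qpartition (col' ord0 b - sv x - sv y)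
                             + \sum_x qpartition (col' ord0 b - sv x *+ 2)).
Proof.
move=> b2; pose N := (height b + \sum_x \sum_y height (col' ord0 b - sv x - sv y)).+2%N.
have hN x y : (height (col' ord0 b - sv x - sv y) <= N)%N.
  rewrite /N (bigD1 x) //= (bigD1 y) //=; lia.
rewrite (@qpartitionE _ N); last by rewrite /N; lia.
rewrite qpart_split b2 (eq_bigl _ _ (fun c => eqz_nat _ 2)) sum_mult2 //.
have E x y : 'X^(\sum_z mult2 N x y z)%N * qpart N (col' ord0 b - \sum_z sv z *+ mult2 N x y z)
    = 'X^2 * qpartition (col' ord0 b - sv x - sv y).
  under eq_bigr do rewrite mult2E //.
  rewrite big_split /= !sumn_delta; congr (_ * _).
  under eq_bigr do rewrite mult2E // mulrnDr.
  by rewrite big_split /= !sum_mulrb_delta opprD addrA -qpartitionE.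
rewrite mulrDr !big_distrr /=; congr (_ + _); apply: eq_bigr => x _.
  by rewrite big_distrr /=; apply: eq_bigr => y _; rewrite E.
by rewrite E mulr2n opprD addrA.
Qed.

End Split.

(** Every root has coordinate sum 0 or 2. *)
Lemma qpartition_odd n (b : 'rV[int]_n) : (2 %| \sum_j b 0 j)%Z = false -> qpartition b = 0.
Proof.
move=> oddb; rewrite /qpartition big_pred0 // => m; apply: contraFF oddb => /eqP <-.
under eq_bigr do rewrite summxE.
rewrite exchange_big /=; apply: (big_ind (fun y => (2 %| y)%Z)) => [|y z|a _].
- exact: dvdz0.
- exact: rpredD.
under eq_bigr do rewrite mulmxnE.
rewrite sumrMnl; apply: rpredMn; case: a => [[[i j] s] ij].
under eq_bigr do rewrite !mxE eqxx /=.
rewrite big_split /= -big_distrr /=.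
have one (k : 'I_n) : \sum_l (l == k)%:R = 1 :> int.
  by rewrite (bigD1 k) //= eqxx big1 ?addr0 // => l /negPf->.
by rewrite !one; case: s {ij}.
Qed.

(** * Alternating sums over the Weyl group *)

Section AlternatingSums.
Variable n : nat.
Implicit Types (w u : sperm n) (g h t : 'rV[int]_n) (x y : 'I_n * bool) (Q : pred (sperm n)).

(** Both [g] and [t] already include [rho], and the sign is that of the underlying permutation. [Q]
    selects a part of the group. *)
Definition altsum Q g t : {poly int} :=
  \sum_(w | weylD w && Q w) (-1) ^+ w.1 * qpartition (g *m sperm_mx w - t).

Definition kD g t := altsum predT g t.

Lemma sact_spmul u w x : sact (spmul u w) x = sact w (sact u x).
Proof. by rewrite /sact /= permM inE addbA. Qed.

Lemma spmul_inj u : injective (spmul u).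
Proof.
move=> v w /(congr1 (@sperm_mx n)); rewrite !sperm_mxM => e; apply: sperm_mx_inj.
have U : sperm_mx u \in unitmx.
  by rewrite unitmxE det_sperm -exprD unitrX // unitrN1.
by rewrite -(mulKmx U (sperm_mx v)) e mulKmx.
Qed.

Lemma altsum_spmul Q u g t : weylD u ->
  altsum (Q \o spmul u) (g *m sperm_mx u) t = (-1) ^+ u.1 * altsum Q g t.
Proof.
move=> Du; rewrite /altsum [in RHS](reindex_inj (@spmul_inj u)) big_distrr /=.
apply: eq_big => [w|w _]; first by rewrite weylD_spmul Du; case: (weylD w).
by rewrite sperm_mxM mulmxA odd_permM signr_addb !mulrA -signr_addb addbb mul1r.
Qed.

Lemma kD_spmul u g t : weylD u -> kD (g *m sperm_mx u) t = (-1) ^+ u.1 * kD g t.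
Proof. by move=> Du; rewrite -(altsum_spmul predT). Qed.

Lemma weylD_srefl (i j : 'I_n) s : i != j -> weylD (srefl i j s).
Proof. by move=> ij; rewrite /weylD; case: s; rewrite /= ?cards0 ?cards2 ?ij. Qed.

(** Stated for any function, so that the rules below apply to [kD^~ t] and also to its sums over
    [g + sv x]. *)
Definition alternating (F : 'rV[int]_n -> {poly int}) :=
  forall u g, weylD u -> F (g *m sperm_mx u) = (-1) ^+ u.1 * F g.

Lemma kD_alternating t : alternating (kD^~ t).
Proof. by move=> u g; apply: kD_spmul. Qed.

Lemma mulmx_srefl (i j : 'I_n) s g h : i != j ->
  h 0 i = (-1) ^+ (~~ s) * g 0 j -> h 0 j = (-1) ^+ (~~ s) * g 0 i ->
  (forall k, k != i -> k != j -> h 0 k = g 0 k) -> h = g *m sperm_mx (srefl i j s).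
Proof.
move=> ij hi hj hk; apply/rowP => k.
rewrite -(tpermK i j k) -[X in _ = _ X]/((srefl i j s).1 _).
rewrite mulmx_sperm /=; move: {k}(tperm i j k) => k.
case: tpermP => [->|->|/eqP ki /eqP kj].
- by rewrite hj; case: (s); rewrite !inE ?eqxx.
- by rewrite hi; case: (s); rewrite !inE ?eqxx ?orbT.
by rewrite hk //; case: (s); rewrite !inE ?(negPf ki) ?(negPf kj) mul1r.
Qed.

Section Alternating.
Variables (F : 'rV[int]_n -> {poly int}) (altF : alternating F).

Lemma alternating_reflect (i j : 'I_n) s g h : i != j ->
  h 0 i = (-1) ^+ (~~ s) * g 0 j -> h 0 j = (-1) ^+ (~~ s) * g 0 i ->
  (forall k, k != i -> k != j -> h 0 k = g 0 k) -> F h = - F g.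
Proof.
move=> ij hi hj hk; rewrite (mulmx_srefl ij hi hj hk).
by rewrite altF ?weylD_srefl // odd_tperm ij mulN1r.
Qed.

(** Such a weight is fixed by a reflection, so [F g = - F g], and integer polynomials have no
    2-torsion. *)
Lemma alternating_eq0 (i j : 'I_n) g :
  i != j -> g 0 i = g 0 j \/ g 0 i = - g 0 j -> F g = 0.
Proof.
move=> ij e; have E : F g = - F g.
  case: e => e; [apply: (@alternating_reflect i j true)|apply: (@alternating_reflect i j false)];
  by rewrite // ?mul1r ?mulN1r ?e ?opprK.
apply/polyP => k; have := congr1 (fun p : {poly int} => p`_k) E.
rewrite /= coefN coef0; set c := _`_k => ce; lia.
Qed.

Lemma alternating_flip2 (i j : 'I_n) g h : i != j ->
  h 0 i = - g 0 i -> h 0 j = - g 0 j ->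
  (forall k, k != i -> k != j -> h 0 k = g 0 k) -> F h = F g.
Proof.
move=> ij hi hj hk; pose u : sperm n := (1%g, [set i; j]).
have -> : h = g *m sperm_mx u.
  apply/rowP => k; rewrite -[X in _ = _ X](perm1 k) -[X in _ = _ X]/(u.1 k) mulmx_sperm !inE.
  have [->|ki] := eqVneq k i; first by rewrite hi mulN1r.
  have [->|kj] := eqVneq k j; first by rewrite hj mulN1r.
  by rewrite hk // mul1r.
by rewrite altF ?odd_perm1 ?mul1r // /weylD /= cards2 ij.
Qed.

(** The Weyl group permutes the weights [sv x]. This allows the Pieri rule for V to be applied twice
    in a row. *)
Lemma alternating_sum_sv : alternating (fun g => \sum_x F (g + sv x)).
Proof.
move=> u g Du; rewrite (reindex_inj (@sact_inj n u)) big_distrr; apply: eq_bigr => x _.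
by rewrite -sv_sperm -mulmxDl altF.
Qed.
End Alternating.

Definition sneg x := (x.1, ~~ x.2).

Lemma svN x : sv (sneg x) = - sv x.
Proof. by rewrite /sv /= signrN scaleNr. Qed.

Lemma sneg_inj : injective sneg.
Proof. by move=> [i s] [j t] [-> /negb_inj ->]. Qed.

(* [x |-> - x w] permutes the weights [sv x]. *)
Lemma sum_sv_shift (V : nmodType) (F : 'rV[int]_n -> V) w g k :
  \sum_x F (g *m sperm_mx w - sv x *+ k) = \sum_x F ((g + sv x *+ k) *m sperm_mx w).
Proof.
rewrite (reindex_inj (inj_comp sneg_inj (@sact_inj n w))); apply: eq_bigr => x _.
by rewrite /= svN mulNrn opprK mulmxDl -!scaler_nat -scalemxAl sv_sperm.
Qed.

Lemma sum_qpartition_shift w g t k :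
  \sum_x qpartition (g *m sperm_mx w - t - sv x *+ k)
  = \sum_x qpartition ((g + sv x *+ k) *m sperm_mx w - t).
Proof.
apply: etrans (sum_sv_shift (fun b => qpartition (b - t)) w g k).
by apply: eq_bigr => x _; rewrite addrAC.
Qed.

Lemma sum_qpartition_shift1 w g t :
  \sum_x qpartition (g *m sperm_mx w - t - sv x)
  = \sum_x qpartition ((g + sv x) *m sperm_mx w - t).
Proof. exact: (sum_qpartition_shift w g t 1). Qed.

Lemma sum_qpartition_shift2 w g t :
  \sum_x \sum_y qpartition (g *m sperm_mx w - t - sv x - sv y)
  = \sum_x \sum_y qpartition ((g + sv x + sv y) *m sperm_mx w - t).
Proof.
transitivity (\sum_x \sum_y qpartition ((g + sv x) *m sperm_mx w - t - sv y)).
  rewrite exchange_big [RHS]exchange_big; apply: eq_bigr => y _ /=.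
  transitivity (\sum_x qpartition (g *m sperm_mx w - (t + sv y) - sv x)).
    by apply: eq_bigr => x _; congr qpartition; rewrite opprD addrA; apply: addrAC.
  rewrite sum_qpartition_shift1; apply: eq_bigr => x _.
  by congr qpartition; rewrite opprD addrA.
by apply: eq_bigr => x _; apply: sum_qpartition_shift1.
Qed.
End AlternatingSums.

Lemma kostka_kD n (la mu : seq nat) :
  kostka_foulkesD n la mu = kD (wt n la + rho n) (wt n mu + rho n).
Proof.
rewrite /kostka_foulkesD /kD /altsum; apply: eq_big => [w|w Dw]; first by rewrite andbT.
by rewrite weyl_length_sign.
Qed.

Lemma addb_false b c : b (+) c = false -> b = c.
Proof. by case: b c => [] []. Qed.

(** * Peeling off the first coordinate in the alternating sum *)

Section Peeling.
Variable m : nat.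
Implicit Types (g t : 'rV[int]_m.+1) (x : 'I_m.+1 * bool).

(* The part of the sum where [g *m sperm_mx w] has first coordinate
   [(-1) ^+ x.2 * g 0 x.1]. *)
Definition kpart x g t := altsum (fun w => sact w x == (ord0, false)) g t.

Lemma kD_kpart g t : kD g t = \sum_x kpart x g t.
Proof.
rewrite /kpart /altsum (exchange_big_dep (fun w => weylD w)) => [|x w _ /andP[]//] /=.
apply: eq_big => [w|w /andP[Dw _]]; first by rewrite andbT.
(* The only index is the preimage of [ord0] together with its own sign, which [w] cancels. *)
rewrite Dw /= (big_pred1 ((w.1^-1)%g ord0, (w.1^-1)%g ord0 \in w.2)) // => [[i s]].
apply/eqP/eqP => [[<- /addb_false ->]|[-> ->]]; first by rewrite permK.
by rewrite /sact /= permKV addbb.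
Qed.

Lemma head_sact x g w : sact w x = (ord0, false) ->
  (g *m sperm_mx w) 0 ord0 = (-1) ^+ x.2 * g 0 x.1.
Proof. by case=> <- /addb_false->; rewrite mulmx_sperm. Qed.

Lemma kpart_eq0 x g t : (-1) ^+ x.2 * g 0 x.1 < t 0 ord0 -> kpart x g t = 0.
Proof.
move=> gt; rewrite /kpart /altsum big1 // => w /andP[_ /eqP wx].
by rewrite qpartition_head_lt0 ?mulr0 // mxE (head_sact _ wx) mxE subr_lt0.
Qed.

(** Brings any part to the index [(ord0, false)], where the peeling formulas below apply. *)
Lemma kpart_spmul u x g t : weylD u ->
  kpart (sact u x) (g *m sperm_mx u) t = (-1) ^+ u.1 * kpart x g t.
Proof.
move=> Du; rewrite -(altsum_spmul _ _ _ Du) /kpart /altsum.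
by apply: eq_bigl => w /=; rewrite sact_spmul.
Qed.

(** The even elements of this form are the stabilizer of the first basis vector in the Weyl
    group. *)
Definition lift_sperm (w : sperm m) : sperm m.+1 :=
  (lift_perm ord0 ord0 w.1, [set lift ord0 i | i in w.2]).

Lemma ord0_notin_lift (E : {set 'I_m}) : (ord0 \in [set lift ord0 i | i in E]) = false.
Proof. by apply/imsetP => -[i _ /eqP]; rewrite (negPf (neq_lift _ _)). Qed.

Lemma mem_lift_imset (E : {set 'I_m}) j :
  (lift ord0 j \in [set lift ord0 i | i in E]) = (j \in E).
Proof. by rewrite mem_imset //; apply: lift_inj. Qed.

Lemma weylD_lift_sperm w : weylD (lift_sperm w) = weylD w.
Proof. by rewrite /weylD card_imset //; apply: lift_inj. Qed.

Lemma sact_lift_sperm w : sact (lift_sperm w) (ord0, false) = (ord0, false).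
Proof. by rewrite /sact /= lift_perm_id ord0_notin_lift. Qed.

Lemma col'_lift_sperm g w :
  col' ord0 (g *m sperm_mx (lift_sperm w)) = col' ord0 g *m sperm_mx w.
Proof.
apply/rowP => j; rewrite -(permKV w.1 j) mulmx_sperm [LHS]mxE [in RHS]mxE.
rewrite -(lift_perm_lift ord0 ord0) -[lift_perm _ _ _]/((lift_sperm w).1) mulmx_sperm.
by rewrite mem_lift_imset.
Qed.

Lemma lift_sperm_surj w : sact w (ord0, false) = (ord0, false) ->
  exists w', w = lift_sperm w'.
Proof.
case: w => s E [s0 E0]; rewrite /= in s0 E0.
have sE k : exists k', s (lift ord0 k) = lift ord0 k'.
  have := neq_lift ord0 k; rewrite -(inj_eq (@perm_inj _ s)) s0.
  by case/unlift_some => k' -> _; exists k'.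
(* The default [k] is never taken: by [sE] the image is always a lifted index. *)
have f_inj : injective (fun k => odflt k (unlift ord0 (s (lift ord0 k)))).
  move=> k l; case: (sE k) (sE l) => [k' sk] [l' sl]; rewrite sk sl !liftK /= => kl.
  by apply: (@lift_inj _ ord0); apply: (@perm_inj _ s); rewrite sk sl kl.
exists (perm f_inj, [set k | lift ord0 k \in E]); congr (_, _).
  apply/permP => k; have [k'|] := unliftP ord0 k => ->; last by rewrite lift_perm_id.
  by rewrite lift_perm_lift permE; case: (sE k') => l ->; rewrite liftK.
apply/setP => k; have [k'|] := unliftP ord0 k => ->.
  by rewrite mem_lift_imset inE.
by rewrite ord0_notin_lift E0.
Qed.

Lemma lift_sperm_inj : injective lift_sperm.
Proof.
move=> [s E] [t F] /= [st /setP EF]; congr (_, _).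
  apply/permP => k; have := congr1 (fun p : {perm _} => p (lift ord0 k)) st.
  by rewrite !lift_perm_lift => /lift_inj.
by apply/setP => k; have := EF (lift ord0 k); rewrite !mem_lift_imset.
Qed.

Lemma kpart_lift g t : kpart (ord0, false) g t
  = \sum_(w | weylD w) (-1) ^+ w.1 * qpartition (g *m sperm_mx (lift_sperm w) - t).
Proof.
rewrite /kpart /altsum.
rewrite (eq_bigl (fun w => w \in lift_sperm @: [set w | weylD w])); last first.
  move=> w; apply/andP/imsetP => [[Dw /eqP/lift_sperm_surj[w' e]]|[w' Dw ->]].
    by exists w' => //; rewrite inE -weylD_lift_sperm -e.
  by rewrite weylD_lift_sperm sact_lift_sperm; rewrite inE in Dw.
rewrite big_imset /=; last by move=> w1 w2 _ _; apply: lift_sperm_inj.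
by apply: eq_big => [w|w _]; rewrite ?inE // odd_lift_perm.
Qed.

Lemma head_lift_sperm g t w :
  (g *m sperm_mx (lift_sperm w) - t) 0 ord0 = g 0 ord0 - t 0 ord0.
Proof. by rewrite mxE (head_sact _ (sact_lift_sperm w)) mul1r mxE. Qed.

Lemma tail_lift_sperm g t w :
  col' ord0 (g *m sperm_mx (lift_sperm w) - t) = col' ord0 g *m sperm_mx w - col' ord0 t.
Proof. by rewrite -col'_lift_sperm; apply/rowP => k; rewrite !mxE. Qed.

Lemma kpart_head0 g t : g 0 ord0 = t 0 ord0 ->
  kpart (ord0, false) g t = kD (col' ord0 g) (col' ord0 t).
Proof.
move=> gt; rewrite kpart_lift /kD /altsum; apply: eq_big => [w|w _]; first by rewrite andbT.
by rewrite qpartition_head0 ?tail_lift_sperm // head_lift_sperm gt subrr.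
Qed.

(** Exactly one root with nonzero first coordinate is used, whence the factor q. Its tail [sv x],
    subtracted after the action of [w], is moved to the other side of [w]. *)
Lemma kpart_head1 g t : g 0 ord0 = t 0 ord0 + 1 ->
  kpart (ord0, false) g t = 'X * \sum_x kD (col' ord0 g + sv x) (col' ord0 t).
Proof.
move=> gt; rewrite kpart_lift /kD /altsum exchange_big /= big_distrr /=.
apply: eq_big => [w|w _]; first by rewrite andbT.
rewrite qpartition_head1 ?tail_lift_sperm; last by rewrite head_lift_sperm gt addrC addKr.
rewrite -big_distrr mulrCA; do 2!congr (_ * _).
exact: sum_qpartition_shift1.
Qed.

Lemma kpart_head2 g t : g 0 ord0 = t 0 ord0 + 2 ->
  kpart (ord0, false) g t *+ 2
  = 'X^2 * (\sum_x \sum_y kD (col' ord0 g + sv x + sv y) (col' ord0 t)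
           + \sum_x kD (col' ord0 g + sv x *+ 2) (col' ord0 t)).
Proof.
move=> gt; rewrite kpart_lift /kD /altsum.
under [X in _ * (X + _)]eq_bigr do rewrite exchange_big /=.
rewrite [X in _ * (X + _)]exchange_big /= [X in _ * (_ + X)]exchange_big /= -big_split.
rewrite big_distrr -sumrMnl /=; apply: eq_big => [w|w _]; first by rewrite andbT.
rewrite -mulrnAr qpartition_head2 ?tail_lift_sperm; last by rewrite head_lift_sperm gt addrC addKr.
rewrite mulrCA -big_distrr; congr (_ * _).
under [X in _ = X + _]eq_bigr do rewrite -big_distrr.
rewrite -big_distrr -mulrDr /=; congr (_ * (_ + _)).
  exact: sum_qpartition_shift2.
exact: sum_qpartition_shift.
Qed.

End Peeling.

(** * Weights shifted by rho *)

Definition shifted n (la : seq nat) : 'rV[int]_n := wt n la + rho n.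

Lemma shiftedE n la (k : 'I_n) : shifted n la 0 k = (nth 0%N la k + (n.-1 - k))%N%:Z.
Proof. by rewrite !mxE PoszD. Qed.

Lemma shifted_svE n la (x : 'I_n * bool) k (j : 'I_n) :
  (shifted n la + sv x *+ k) 0 j =
  (nth 0%N la j + (n.-1 - j))%N%:Z + (-1) ^+ x.2 * (k%:Z * (j == x.1 :> nat)%N%:Z).
Proof.
rewrite mxE shiftedE mulmxnE svE; congr (_ + _).
by rewrite -mulrnAr -[k%:Z]natz mulr_natl -[Posz (nat_of_bool _)]natz.
Qed.

Lemma shifted_sv1 n la (i : 'I_n) (s : bool) (j : 'I_n) :
  (shifted n la + sv (i, s)) 0 j =
  (nth 0%N la j + (n.-1 - j))%N%:Z + (-1) ^+ s * (j == i :> nat)%N%:Z.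
Proof. by have := shifted_svE la (i, s) 1 j; rewrite mulr1n mul1r. Qed.

Lemma nth_part1 a k : nth 0%N [:: a] k = ((k == 0) * a)%N.
Proof. by case: k => [|[|k]] /=; rewrite ?mul1n ?mul0n. Qed.

Lemma nth_part2 a b k : nth 0%N [:: a; b] k = ((k == 0) * a + (k == 1) * b)%N.
Proof. by case: k => [|[|[|k]]] /=; rewrite ?mul1n ?mul0n ?addn0. Qed.

Lemma col'_shifted m a la : col' ord0 (shifted m.+1 (a :: la)) = shifted m la.
Proof. by apply/rowP => j; rewrite mxE !shiftedE lift0 /=; congr (Posz (_ + _)); lia. Qed.

(** Gives the zero weight an explicit first part, as the peeling lemmas require. *)
Lemma shifted_nil n : shifted n [::] = shifted n [:: 0%N].
Proof. by apply/rowP => j; rewrite !shiftedE nth_part1 muln0 nth_nil. Qed.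

Lemma head_shifted m a la : shifted m.+1 (a :: la) 0 ord0 = (a + m)%N%:Z.
Proof. by rewrite shiftedE subn0. Qed.

Lemma kD_peel m (g t : 'rV[int]_m.+1) : - g 0 ord0 < t 0 ord0 ->
  (forall j : 'I_m, `|g 0 (lift ord0 j)| < t 0 ord0) -> kD g t = kpart (ord0, false) g t.
Proof.
move=> g0 gS; rewrite kD_kpart (bigD1 (ord0, false)) //= big1 ?addr0 // => [[i s]] ne.
apply: kpart_eq0 => /=; have [j|] := unliftP ord0 i => iE; rewrite {}iE in ne *.
  by apply: le_lt_trans (gS j); case: (s); rewrite ?mul1r ?mulN1r ?ler_norm // -normrN ler_norm.
by case: s ne; rewrite ?eqxx // mulN1r.
Qed.

(** The target starts with [b + m], whereas the coordinates after the first are at most [b + m - 1];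
    [0 < m] keeps [- (a + m)] below the target. *)
Lemma kD_peel_shifted m a b la mu : (0 < m)%N -> (forall j, nth 0 la j <= b)%N ->
  kD (shifted m.+1 (a :: la)) (shifted m.+1 (b :: mu))
  = kpart (ord0, false) (shifted m.+1 (a :: la)) (shifted m.+1 (b :: mu)).
Proof.
move=> m0 lab; apply: kD_peel => [|j]; rewrite !shiftedE ?lift0 /=; first by lia.
by have := lab j; have := ltn_ord j; lia.
Qed.

Lemma kD_peel0 m a la mu : (0 < m)%N -> (forall j, nth 0 la j <= a)%N ->
  kD (shifted m.+1 (a :: la)) (shifted m.+1 (a :: mu)) = kD (shifted m la) (shifted m mu).
Proof.
by move=> m0 lab; rewrite kD_peel_shifted // kpart_head0 ?head_shifted // !col'_shifted.
Qed.

Lemma kD_peel1 m b la mu : (0 < m)%N -> (forall j, nth 0 la j <= b)%N ->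
  kD (shifted m.+1 (b.+1 :: la)) (shifted m.+1 (b :: mu))
  = 'X * \sum_x kD (shifted m la + sv x) (shifted m mu).
Proof.
move=> m0 lab; rewrite kD_peel_shifted // kpart_head1 ?head_shifted ?col'_shifted //.
by rewrite addSn -addn1.
Qed.

Lemma kD_peel2 m b la mu : (0 < m)%N -> (forall j, nth 0 la j <= b)%N ->
  kD (shifted m.+1 (b.+2 :: la)) (shifted m.+1 (b :: mu)) *+ 2
  = 'X^2 * (\sum_x \sum_y kD (shifted m la + sv x + sv y) (shifted m mu)
           + \sum_x kD (shifted m la + sv x *+ 2) (shifted m mu)).
Proof.
move=> m0 lab; rewrite kD_peel_shifted // kpart_head2 ?head_shifted ?col'_shifted //.
by rewrite !addSn -addn2.
Qed.

(** D_1 has no roots and a trivial Weyl group. This starts the recursions on the rank. *)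
Lemma kD_rank1 (g t : 'rV[int]_1) : kD g t = (g 0 ord0 == t 0 ord0)%:R.
Proof.
have no_root (a : posroot 1) : False.
  by case: a => [[[i j] s] /= ij]; move: (ltn_ord i) (ltn_ord j) ij; lia.
have q1 b : qpartition b = (b == 0 :> 'rV[int]_1)%:R.
  rewrite -qpartition_generating (big_pred1 set0) => [|A].
    by rewrite cards0 mul1r big_set0 subr0.
  by symmetry; apply/eqP/setP => a; case: (no_root a).
rewrite /kD /altsum (big_pred1 (sp1 1)) => [|[s E]]; last first.
  rewrite andbT /weylD; apply/idP/eqP => [/= oE|->]; last by rewrite /= cards0.
  congr (_, _); first by apply/permP => k; rewrite !ord1.
  apply: cards0_eq; have := max_card E; rewrite card_ord; by case: #|E| oE => [|[|]].
rewrite odd_perm1 mul1r sperm_mx1 mulmx1 q1 subr_eq0 rV_eq_split.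
by rewrite [X in _ && X](_ : _ = true) ?andbT //; apply/eqP/rowP => -[].
Qed.

Lemma sumn_wt n la : (size la <= n)%N -> \sum_j wt n la 0 j = (sumn la)%:Z.
Proof.
move=> ln; under eq_bigr do rewrite mxE.
rewrite -(big_mkord predT (fun k => (nth 0%N la k)%:Z)) (big_cat_nat _ ln) //=.
rewrite [X in _ + X]big_nat_cond [X in _ + X]big1 ?addr0 => [|k kP]; last first.
  by rewrite nth_default //; lia.
have -> : sumn la = (\sum_(0 <= k < size la) nth 0 la k)%N by rewrite sumnE (big_nth 0%N).
by rewrite (big_morph Posz PoszD (erefl _)).
Qed.

(** A sign change alters the coordinate sum by an even number, so its parity is the same for all
    [g *m sperm_mx w]. *)
Lemma kD_parity n (g t : 'rV[int]_n) :
  (2 %| \sum_j (g 0 j - t 0 j))%Z = false -> kD g t = 0.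
Proof.
move=> gt; rewrite /kD /altsum big1 // => w _; rewrite qpartition_odd ?mulr0 //.
have even_diff : (2 %| \sum_j (g 0 j - (g *m sperm_mx w) 0 j))%Z.
  rewrite sumrB [X in _ - X](reindex_inj (@perm_inj _ w.1)) /= -sumrB.
  apply: (big_ind (fun y => (2 %| y)%Z)) => [|y z|j _]; [exact: dvdz0|exact: rpredD|].
  rewrite mulmx_sperm; case: (j \in w.2); last by rewrite mul1r subrr dvdz0.
  by rewrite mulN1r opprK; apply/dvdzP; exists (g 0 j); ring.
rewrite -gt -[RHS](rpredBr _ even_diff) -sumrB; congr (_ %| _)%Z.
by apply: eq_bigr => j _; rewrite [LHS]mxE [(- t) 0 j]mxE; ring.
Qed.

Lemma kD_shifted_parity n la mu : (size la <= n)%N -> (size mu <= n)%N ->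
  odd (sumn la + sumn mu) -> kD (shifted n la) (shifted n mu) = 0.
Proof.
move=> ln mn o; apply: kD_parity.
under eq_bigr do rewrite [shifted _ la _ _]mxE [shifted _ mu _ _]mxE opprD addrACA subrr addr0.
rewrite sumrB !sumn_wt //; lia.
Qed.

(** * Pieri rules *)

Lemma big_supp2 (V : nmodType) (I : finType) (i j : I) (F : I -> V) : i != j ->
  (forall k, k != i -> k != j -> F k = 0) -> \sum_k F k = F i + F j.
Proof.
move=> ij F0; rewrite (bigD1 i) //= (bigD1 j) 1?eq_sym //=.
by rewrite [X in _ + (_ + X)]big1 ?addr0 // => k /andP[ki kj]; apply: F0.
Qed.

Lemma sum_prod_bool (V : nmodType) (I : finType) (F : I * bool -> V) :
  \sum_x F x = \sum_i F (i, false) + \sum_i F (i, true).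
Proof.
rewrite -big_split; under [RHS]eq_bigr => i _ do
  rewrite /= addrC -[F (i, true) + _]/((fun b => F (i, b)) true + (fun b => F (i, b)) false)
    -big_bool.
by rewrite pair_bigA; apply: eq_bigr => -[].
Qed.

Definition sv_coordE :=
  (shifted_svE, shiftedE, mul1r, mulN1r, expr0, expr1).

Section Straightening.
Variable p : nat.
Local Notation m := p.+2.
Variables (F : 'rV[int]_m -> {poly int}) (altF : alternating F).
Local Notation o0 := (ord0 : 'I_m).
Local Notation o1 := (@Ordinal m 1 isT).
Implicit Types (k : 'I_m) (la : seq nat).


(** After the addition the coordinates [k - 1] and [k] agree; in [vanish_down] it is [k] and
    [k + 1], and in [vanish_last] the last two become 1 and -1. *)
Lemma vanish_up la k : (0 < k)%N -> nth 0%N la k = nth 0%N la k.-1 ->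
  F (shifted m la + sv (k, false)) = 0.
Proof.
move=> k0 e; have k1 : (k.-1 < m)%N by have := ltn_ord k; lia.
apply: (alternating_eq0 altF (i := k) (j := Ordinal k1)).
  by rewrite -val_eqE /=; lia.
by left; rewrite !shifted_sv1 /= e; have := ltn_ord k; lia.
Qed.

Lemma vanish_down la k : (k.+1 < m)%N -> nth 0%N la k = nth 0%N la k.+1 ->
  F (shifted m la + sv (k, true)) = 0.
Proof.
move=> k1 e; apply: (alternating_eq0 altF (i := k) (j := Ordinal k1)).
  by rewrite -val_eqE /=; lia.
by left; rewrite !shifted_sv1 /= e; have := ltn_ord k; lia.
Qed.

Lemma vanish_last la : nth 0%N la m.-2 = 0%N -> nth 0%N la m.-1 = 0%N ->
  F (shifted m la + sv (ord_max, true)) = 0.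
Proof.
move=> e1 e2; have k1 : (m.-2 < m)%N by lia.
apply: (alternating_eq0 altF (i := ord_max) (j := Ordinal k1)).
  by rewrite -val_eqE /=; lia.
by right; rewrite !shifted_sv1 /= in e1 e2 *; lia.
Qed.

Lemma sum_sv_rho :
  \sum_x F (shifted m [::] + sv x) = F (shifted m [:: 1%N]).
Proof.
rewrite sum_prod_bool [X in _ + X]big1 ?addr0 => [|k _].
  rewrite (bigD1 o0) //= big1 ?addr0 => [|k k0].
    by congr F; apply/rowP => j; rewrite shifted_sv1 !sv_coordE /= ?nth_part1 ?nth_nil; lia.
  by apply: vanish_up; rewrite ?nth_nil // lt0n.
have [k1|k1] := ltnP k.+1 m; first by apply: vanish_down; rewrite ?nth_nil.
have -> : k = ord_max by apply/val_inj => /=; have := ltn_ord k; lia.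
by apply: vanish_last; rewrite ?nth_nil.
Qed.

(* The last summand is nonzero only in rank 2, where [eps 0 - eps 1] is dominant. *)
Lemma sum_sv_vector :
  \sum_x F (shifted m [:: 1%N] + sv x)
  = F (shifted m [:: 2%N]) + F (shifted m [:: 1; 1]%N) + F (shifted m [::])
    + F (shifted m [:: 1%N] + sv (o1, true)).
Proof.
rewrite sum_prod_bool !(@big_supp2 _ _ o0 o1) //=; last 2 first.
- move=> k k0 k1; have k2 : (1 < k)%N by move: k0 k1; rewrite -!val_eqE /=; lia.
  have [kl|kl] := ltnP k.+1 m; first by apply: vanish_down; rewrite ?nth_part1 //; lia.
  have -> : k = ord_max by apply/val_inj => /=; have := ltn_ord k; lia.
  have km := ltn_ord k.
  by apply: vanish_last; rewrite ?nth_part1; lia.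
- move=> k k0 k1; have k2 : (1 < k)%N by move: k0 k1; rewrite -!val_eqE /=; lia.
  by apply: vanish_up; rewrite ?nth_part1; lia.
rewrite !addrA; congr (_ + _ + _ + _); congr F; apply/rowP => j;
  by rewrite shifted_sv1 !sv_coordE /= ?nth_part1 ?nth_part2 ?nth_nil; lia.
Qed.

(** The power sum p_2 of the weights of V is the character of Sym^2 V minus that of its exterior
    square; the last summand belongs to the exterior square in rank 2. *)
Lemma sum_sv_double :
  \sum_x F (shifted m [::] + sv x *+ 2)
  = F (shifted m [:: 2%N]) - F (shifted m [:: 1; 1]%N) + F (shifted m [::])
    - F (shifted m [:: 1%N] + sv (o1, true)).
Proof.
have q1 : (m.-2 < m)%N by lia.
pose q : 'I_m := Ordinal q1.
rewrite sum_prod_bool (@big_supp2 _ _ o0 o1) //; last first.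
  (* Raising coordinate [k >= 2] of [rho] by 2 makes it equal to coordinate [k - 2]. *)
  move=> k k0 k1; have k2 : (k.-2 < m)%N by have := ltn_ord k; lia.
  apply: (alternating_eq0 altF (i := k) (j := Ordinal k2)).
    by move: k0 k1; rewrite -!val_eqE /=; lia.
  left; rewrite !sv_coordE /= !nth_nil; have := ltn_ord k.
  by move: k0 k1; rewrite -!val_eqE /=; lia.
rewrite (@big_supp2 _ _ q ord_max); last 2 first.
- by rewrite -val_eqE /=; lia.
- move=> k k0 k1; have k2 : (k.+2 < m)%N.
    by have := ltn_ord k; move: k0 k1; rewrite -!val_eqE /=; lia.
  apply: (alternating_eq0 altF (i := k) (j := Ordinal k2)).
    by rewrite -!val_eqE /=; lia.
  by left; rewrite !sv_coordE /= ?nth_part1 ?nth_part2 ?nth_nil; lia.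
have -> : shifted m [::] + sv (o0, false) *+ 2 = shifted m [:: 2%N].
  by apply/rowP => j; rewrite !sv_coordE /= ?nth_part1 ?nth_part2 ?nth_nil; lia.
have -> : F (shifted m [::] + sv (o1, false) *+ 2) = - F (shifted m [:: 1; 1]%N).
  apply: (alternating_reflect altF (i := o0) (j := o1) (s := true)) => // [||k].
  - by rewrite !sv_coordE /= ?nth_part1 ?nth_part2 ?nth_nil; lia.
  - by rewrite !sv_coordE /= ?nth_part1 ?nth_part2 ?nth_nil; lia.
  - by rewrite -!val_eqE !sv_coordE /= ?nth_part1 ?nth_part2 ?nth_nil; lia.
(* The last two coordinates become -1 and 0, and the zero absorbs the second sign change. *)
have -> : F (shifted m [::] + sv (q, true) *+ 2) = F (shifted m [::]).
  apply: (alternating_flip2 altF (i := q) (j := ord_max)) => [|||k].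
  - by rewrite -val_eqE /=; lia.
  - by rewrite !sv_coordE /= ?nth_part1 ?nth_part2 ?nth_nil; lia.
  - by rewrite !sv_coordE /= ?nth_part1 ?nth_part2 ?nth_nil; lia.
  - by rewrite -!val_eqE !sv_coordE /= ?nth_part1 ?nth_part2 ?nth_nil; lia.
suff -> : F (shifted m [::] + sv (ord_max, true) *+ 2) = - F (shifted m [:: 1%N] + sv (o1, true)).
  by rewrite !addrA.
(* In rank 2 the reflection in [eps 0 + eps 1] exchanges [(1,-2)] and [(2,-1)]. In higher rank both
   sides vanish: the last coordinate -2 is opposite to coordinate [p - 1]. *)
have [p0|p0] := eqVneq p 0%N.
  apply: (alternating_reflect altF (i := o0) (j := o1) (s := false)) => // [||k].
  - by rewrite shifted_sv1 !sv_coordE /= ?nth_part1 ?nth_part2 ?nth_nil; lia.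
  - by rewrite shifted_sv1 !sv_coordE /= ?nth_part1 ?nth_part2 ?nth_nil; lia.
  - have := ltn_ord k.
    by rewrite -!val_eqE shifted_sv1 !sv_coordE /= ?nth_part1 ?nth_part2 ?nth_nil; lia.
have q2 : (p.-1 < m)%N by lia.
rewrite (alternating_eq0 altF (i := ord_max) (j := Ordinal q2)); last 2 first.
- by rewrite -val_eqE /=; lia.
- by right; rewrite !sv_coordE /= ?nth_part1 ?nth_part2 ?nth_nil; lia.
by rewrite vanish_down ?oppr0 //=; lia.
Qed.
End Straightening.

(** * Recursions and closed forms *)

Definition KD n la mu := kD (shifted n la) (shifted n mu).

Lemma poly_double_inj (p q : {poly int}) : p *+ 2 = q *+ 2 -> p = q.
Proof.
move=> e; apply/polyP => k; have := congr1 (fun r : {poly int} => r`_k) e.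
by rewrite !mulr2n !coefD; set a := p`_k; set b := q`_k => ab; lia.
Qed.

Lemma KD_nil_r n la : KD n la [::] = KD n la [:: 0%N].
Proof. by rewrite /KD [shifted n [::]]shifted_nil. Qed.

Lemma KD_nil_nil n : (0 < n)%N -> KD n [::] [::] = 1.
Proof.
elim: n => [//|[|m] IHm _]; first by rewrite /KD kD_rank1 eqxx.
rewrite /KD shifted_nil kD_peel0 //; last by move=> j; rewrite nth_nil.
exact: IHm.
Qed.

Lemma KD_vec_vec n : (0 < n)%N -> KD n [:: 1%N] [:: 1%N] = 1.
Proof.
case: n => [//|[|m] _]; first by rewrite /KD kD_rank1 eqxx.
rewrite /KD kD_peel0 //; last by move=> j; rewrite nth_nil.
exact: KD_nil_nil.
Qed.

Lemma KD2_rank1 : KD 1 [:: 2%N] [::] = 0.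
Proof. by rewrite /KD kD_rank1 !shiftedE. Qed.

Lemma sum_sv_rank1 (V : nmodType) (G : 'I_1 * bool -> V) :
  \sum_x G x = G (ord0, false) + G (ord0, true).
Proof. by rewrite sum_prod_bool !big_ord1. Qed.

(** This is 2 h_2 = p_1^2 + p_2 with Sym^2 V the sum of the representation of highest weight (2) and
    the trivial one; the contributions of the exterior square cancel. *)
Lemma Sym2_straighten m : (0 < m)%N ->
  \sum_x \sum_y kD (shifted m [::] + sv x + sv y) (shifted m [::])
  + \sum_x kD (shifted m [::] + sv x *+ 2) (shifted m [::]) = (KD m [:: 2%N] [::] + 1) *+ 2.
Proof.
case: m => [//|[|p] _].
  rewrite !sum_sv_rank1 KD2_rank1 !kD_rank1 !mxE /=.
  rewrite !mulr1n. ring.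
rewrite (sum_sv_rho (alternating_sum_sv (kD_alternating _))).
rewrite (sum_sv_vector (kD_alternating _)) (sum_sv_double (kD_alternating _)).
rewrite -/(KD _ _ _) -/(KD _ [::] _) KD_nil_nil //.
set u := kD _ _; set v := kD _ _; rewrite /KD; ring.
Qed.

Lemma KD2_rec m : (0 < m)%N -> KD m.+1 [:: 2%N] [::] = 'X^2 * (KD m [:: 2%N] [::] + 1).
Proof.
move=> m0; apply: poly_double_inj; rewrite KD_nil_r /KD kD_peel2 // => [|j]; last first.
  by rewrite nth_nil.
by rewrite Sym2_straighten // mulrnAr.
Qed.

(** The first coordinate again exceeds the target by 2 and the tail is again [rho], so the right
    side is that of [KD2_rec]. *)
Lemma KD3_1 m : (0 < m)%N -> KD m.+1 [:: 3%N] [:: 1%N] = 'X^2 * (KD m [:: 2%N] [::] + 1).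
Proof.
move=> m0; apply: poly_double_inj; rewrite /KD kD_peel2 // => [|j]; last first.
  by rewrite nth_nil.
by rewrite Sym2_straighten // mulrnAr.
Qed.

(** The quotient (q^(2n) - 1) / (q^2 - 1) as a polynomial. *)
Definition evenX n : {poly int} := \sum_(i < n) 'X^(2 * i).

Lemma evenXS n : evenX n.+1 = 1 + 'X^2 * evenX n.
Proof.
rewrite /evenX big_ord_recl expr0 big_distrr /=; congr (_ + _).
by apply: eq_bigr => i _; rewrite -exprD; congr ('X^_); rewrite mulnS.
Qed.

Lemma KD2 m : KD m.+1 [:: 2%N] [::] = 'X^2 * evenX m.
Proof.
elim: m => [|m IHm]; first by rewrite KD2_rank1 /evenX big_ord0 mulr0.
by rewrite KD2_rec // IHm evenXS addrC.
Qed.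

(** The quantity [A_m] of the recursion, left unexpanded so that it also covers rank 1, where
    [sum_sv_vector] does not apply. *)
Definition vector_square m := \sum_x kD (shifted m [:: 1%N] + sv x) (shifted m [::]).

(** Two coordinates of [(1,1) + rho] reach the first coordinate of the target: the first one exceeds
    it by 1, the second one equals it. *)
Lemma KD11_rec m : (0 < m)%N ->
  KD m.+1 [:: 1; 1]%N [::] = 'X * vector_square m - KD m [:: 2%N] [::].
Proof.
case: m => [//|m] _; rewrite KD_nil_r /KD /vector_square.
pose o1 : 'I_m.+2 := @Ordinal m.+2 1 isT.
set g := shifted _ [:: 1; 1]%N; set t := shifted _ [:: 0%N].
rewrite kD_kpart (bigD1 (ord0, false)) //= (bigD1 (o1, false)) //=.
rewrite [X in _ + (_ + X)]big1 => [|[i s] /andP[/eqP n0 /eqP n1]]; last first.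
  apply: kpart_eq0; rewrite !shiftedE nth_part2 nth_part1 /=.
  have i_lt := ltn_ord i; case: s n0 n1 => n0 n1; first by rewrite mulN1r; lia.
  have i0 : i != 0%N :> nat by apply/eqP => i0; apply: n0; congr (_, _); apply: val_inj.
  have i1 : i != 1%N :> nat by apply/eqP => i1; apply: n1; congr (_, _); apply: val_inj.
  by rewrite mul1r; lia.
rewrite addr0; congr (_ + _).
  by rewrite kpart_head1 ?head_shifted ?col'_shifted // addrC.
have o01 : ord0 != o1 by [].
have := kpart_spmul (o1, false) g t (weylD_srefl true o01).
rewrite /sact /= tpermR inE odd_tperm o01 mulN1r => /(canLR opprK) <-; congr (- _).
(* Exchanging the first two coordinates of [(1,1) + rho] gives [(0,2) + rho], whose tail is
   [(2) + rho] in lower rank; the transposition contributes the minus sign. *)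
have <- : shifted m.+2 [:: 0; 2]%N = g *m sperm_mx (srefl ord0 o1 true).
  apply: mulmx_srefl => // [||k k0 k1]; rewrite !shiftedE ?mul1r ?nth_part2 /=; try lia.
  by move: k0 k1; rewrite -!val_eqE /=; lia.
by rewrite kpart_head0 ?head_shifted // !col'_shifted.
Qed.

Lemma vector_square_rank1 : vector_square 1 = 1.
Proof. by rewrite /vector_square sum_sv_rank1 !kD_rank1 !shifted_sv1 !shiftedE /= add0r. Qed.

(* [eps 0 - eps 1] in rank 2: the outer automorphism image of the weight [1,1]. *)
Lemma kD_rank2_antiselfdual :
  kD (shifted 2 [:: 1%N] + sv (@Ordinal 2 1 isT, true)) (shifted 2 [::]) = 'X.
Proof.
rewrite shifted_nil; pose o1 : 'I_2 := @Ordinal 2 1 isT.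
set g := _ + _; set t := shifted _ _.
have g0 : g 0 ord0 = 2 by rewrite shifted_sv1 nth_part1 mulN1r.
have g1 : g 0 o1 = -1 by rewrite shifted_sv1 nth_part1 mulN1r.
have t0 : t 0 ord0 = 1 by rewrite head_shifted.
have o01 : ord0 != o1 by [].
have ord2 (i : 'I_2) : i = ord0 \/ i = o1.
  by case: i => [[|[|//]] ij]; [left|right]; apply: val_inj.
have tE : col' ord0 t = shifted 1 [::] by rewrite col'_shifted.
rewrite kD_kpart (bigD1 (ord0, false)) //= (bigD1 (o1, true)) //=.
rewrite [X in _ + (_ + X)]big1 => [|[i s]]; last first.
  by case: (ord2 i) => ->; case: s => // _; apply: kpart_eq0; rewrite ?g0 ?g1 t0.
have := kpart_spmul (o1, true) g t (weylD_srefl false o01).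
rewrite /sact /= tpermR !inE eqxx orbT odd_tperm o01 mulN1r => /(canLR opprK) <-.
(* The reflection takes [(2,-1)] to [(1,-2)]; the tail -2 differs from the rank 1 target 0, so this
   part vanishes. *)
pose h : 'rV[int]_2 := \row_i (if i == ord0 then 1 else -2).
have <- : h = g *m sperm_mx (srefl ord0 o1 false).
  apply: mulmx_srefl => //; rewrite ?mxE /= ?g0 ?g1 //.
  by move=> k; case: (ord2 k) => ->.
rewrite (kpart_head1 (g := g)) ?g0 ?t0 // (kpart_head0 (g := h)); last by rewrite mxE t0.
have lift0 : lift ord0 ord0 = o1 by apply: val_inj.
have c0 x : (col' ord0 g + sv x) 0 ord0 = -1 + sv x 0 ord0.
  by rewrite mxE [col' _ _ _ _]mxE lift0 g1.
have h0 : col' ord0 h 0 ord0 = -2 by rewrite mxE lift0 mxE.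
rewrite tE sum_sv_rank1 !kD_rank1 !c0 h0 !svE !shiftedE /=.
by rewrite oppr0 !addr0 mulr1.
Qed.

(** The last bracket is the value for (1,1) in rank at least 3. In rank 2 that value is only q, and
    the extra term of [kD_rank2_antiselfdual] supplies the other q. *)
Lemma vector_square_closed p :
  vector_square p.+2 = 'X^2 * evenX p.+1 + 1 + ('X^(p.+1) + 'X * evenX p.+1).
Proof.
elim: p => [|p IHp]; rewrite {1}/vector_square (sum_sv_vector (kD_alternating _)).
  rewrite -!/(KD _ _ _) kD_rank2_antiselfdual KD_nil_nil // KD11_rec // vector_square_rank1.
  by rewrite KD2_rank1 KD2 evenXS /evenX big_ord0; ring.
rewrite (vanish_down (kD_alternating _)) // -!/(KD _ _ _) KD_nil_nil // KD11_rec // IHp !KD2.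
by rewrite (evenXS p.+1) !exprS; ring.
Qed.

Lemma KD11 p : KD p.+3 [:: 1; 1]%N [::] = 'X^(p.+2) + 'X * evenX p.+2.
Proof. by rewrite KD11_rec // vector_square_closed KD2 (evenXS p.+1) !exprS; ring. Qed.

Lemma KD21_1 m : (0 < m)%N -> KD m.+1 [:: 2; 1]%N [:: 1%N] = 'X * vector_square m.
Proof. by move=> m0; rewrite /KD kD_peel1 // => -[|[|j]]. Qed.

Lemma KD111_1 m : (0 < m)%N -> KD m.+1 [:: 1; 1; 1]%N [:: 1%N] = KD m [:: 1; 1]%N [::].
Proof. by move=> m0; rewrite /KD kD_peel0 // => -[|[|[|j]]]. Qed.

Lemma KD2_11 m : (0 < m)%N -> KD m.+1 [:: 2%N] [:: 1; 1]%N = 'X.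
Proof.
move=> m0; rewrite /KD kD_peel1 // => [|j]; last by rewrite nth_nil.
case: m m0 => [//|[|p]] _; last first.
  by rewrite (sum_sv_rho (kD_alternating _)) -/(KD _ _ _) KD_vec_vec // mulr1.
by rewrite sum_sv_rank1 !kD_rank1 !shifted_sv1 !shiftedE /= addr0 mulr1.
Qed.

Lemma KD2_2 m : (0 < m)%N -> KD m.+1 [:: 2%N] [:: 2%N] = 1.
Proof.
move=> m0; rewrite /KD kD_peel0 // => [|j]; [exact: KD_nil_nil | by rewrite nth_nil].
Qed.

Lemma KD11_11 m : (0 < m)%N -> KD m.+1 [:: 1; 1]%N [:: 1; 1]%N = 1.
Proof.
by move=> m0; rewrite /KD kD_peel0 // => [|[|[|j]]] //; exact: KD_vec_vec.
Qed.

(** All coordinates of [(1,1) + rho] are at most [m + 1] in absolute value, whereas the target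
    starts with [m + 2]. *)
Lemma KD11_2 m : (0 < m)%N -> KD m.+1 [:: 1; 1]%N [:: 2%N] = 0.
Proof.
move=> m0; rewrite /KD kD_kpart big1 // => [[i s]] _; apply: kpart_eq0.
rewrite !shiftedE nth_part2 nth_part1 /=.
by have := ltn_ord i; case: s; rewrite ?mul1r ?mulN1r; lia.
Qed.

(** * The closed forms as rational functions of q *)

Lemma Xn_sub1_neq0 k : (0 < k)%N -> tofrac 'X ^+ k - 1 != 0 :> {fraction {poly int}}.
Proof.
move=> k0; rewrite -tofracXn -tofrac1 -tofracB tofrac_eq0 -polyC1.
exact/monic_neq0/monicXnsubC.
Qed.

Lemma evenX_frac k :
  tofrac (evenX k) = (tofrac 'X ^+ (2 * k) - 1) / (tofrac 'X ^+ 2 - 1) :> {fraction {poly int}}.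
Proof.
apply: (canRL (mulfK (Xn_sub1_neq0 (isT : 0 < 2)%N))).
rewrite -!tofracXn -tofrac1 -!tofracB -tofracM; congr tofrac.
rewrite exprM [RHS]subrX1 mulrC; congr (_ * _); apply: eq_bigr => i _; exact: exprM.
Qed.

(** Merges the even and the odd powers of q into one geometric sum with denominator q - 1; it is
    applied with [a = q ^+ (2 * p.+1)] and [b = q ^+ p.+1]. *)
Lemma geometric_split (F : fieldType) (x a b : F) : x - 1 != 0 -> x ^+ 2 - 1 != 0 ->
  x * ((a * x * x - 1) / (x ^+ 2 - 1) + (b + x * ((a - 1) / (x ^+ 2 - 1))))
  = x * b + x * ((a * x - 1) / (x - 1)).
Proof.
by move=> x1 x2; field; rewrite x1 x2.
Qed.

Theorem mainTheorem8 (n : nat) (n_ge2 : (2 <= n)%N) :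
  let q : {fraction {poly int}} := tofrac 'X in
  let K : seq nat -> seq nat -> {fraction {poly int}} :=
    fun la mu => tofrac (kostka_foulkesD n la mu) in
  [/\ [/\ K [:: 3]%N [:: 2]%N = 0,
          K [:: 3]%N [:: 1; 1]%N = 0,
          K [:: 3]%N [::] = 0 &
          K [:: 3]%N [:: 1]%N = q ^+ 2 * ((q ^+ (2 * n - 2) - 1) / (q ^+ 2 - 1))],
      [/\ K [:: 2; 1]%N [:: 2]%N = 0,
          K [:: 2; 1]%N [:: 1; 1]%N = 0,
          K [:: 2; 1]%N [::] = 0 &
          (3 <= n)%N ->
          K [:: 2; 1]%N [:: 1]%N =
            q ^+ (n - 1) + q * ((q ^+ (2 * n - 3) - 1) / (q - 1))],
      (3 <= n)%N ->
      [/\ K [:: 1; 1; 1]%N [:: 2]%N = 0,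
          K [:: 1; 1; 1]%N [:: 1; 1]%N = 0,
          K [:: 1; 1; 1]%N [::] = 0 &
          (4 <= n)%N ->
          K [:: 1; 1; 1]%N [:: 1]%N =
            q ^+ (n - 2) + q * ((q ^+ (2 * n - 4) - 1) / (q ^+ 2 - 1))],
      [/\ K [:: 2]%N [:: 2]%N = 1,
          K [:: 2]%N [:: 1; 1]%N = q,
          K [:: 2]%N [:: 1]%N = 0 &
          K [:: 2]%N [::] = q ^+ 2 * ((q ^+ (2 * n - 2) - 1) / (q ^+ 2 - 1))] &
      [/\ K [:: 1; 1]%N [:: 2]%N = 0,
          K [:: 1; 1]%N [:: 1; 1]%N = 1,
          K [:: 1; 1]%N [:: 1]%N = 0 &
          (3 <= n)%N ->
          K [:: 1; 1]%N [::] =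
            q ^+ (n - 1) + q * ((q ^+ (2 * n - 2) - 1) / (q ^+ 2 - 1))]].
Proof.
move=> q K; have KE la mu : K la mu = tofrac (KD n la mu) by rewrite /K kostka_kD.
have K0 la mu : (size la <= n)%N -> (size mu <= n)%N -> odd (sumn la + sumn mu) -> K la mu = 0.
  by move=> ln mn o; rewrite KE /KD kD_shifted_parity // tofrac0.
have n1 : (1 <= n)%N by lia.
case: n n_ge2 n1 @K KE K0 => [//|m] m1 _ K KE K0; rewrite ltnS in m1.
have q1 : q - 1 != 0 by apply: (@Xn_sub1_neq0 1).
have q2 : q ^+ 2 - 1 != 0 by apply: Xn_sub1_neq0.
have evenE k : tofrac (evenX k) = (q ^+ (2 * k) - 1) / (q ^+ 2 - 1) by rewrite evenX_frac.
have KD2E k : tofrac ('X^2 * (KD k.+1 [:: 2%N] [::] + 1))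
    = q ^+ 2 * ((q ^+ (2 * k.+2 - 2) - 1) / (q ^+ 2 - 1)).
  by rewrite KD2 addrC -evenXS tofracM tofracXn evenE; congr (_ * ((_ ^+ _ - _) / _)); lia.
have KD11E p : tofrac (KD p.+3 [:: 1; 1]%N [::])
    = q ^+ p.+2 + q * ((q ^+ (2 * p.+2) - 1) / (q ^+ 2 - 1)).
  by rewrite KD11 tofracD tofracXn tofracM evenE.
(* [K0] settles all values for which the sizes of the two partitions have an odd sum. *)
split; [| |move=> m2| |]; split; try exact: K0; try (move=> m3); rewrite KE.
- by case: m m1 {K KE K0} => // p _; rewrite KD3_1 // KD2E.
- case: m m1 m3 {K KE K0} => [|[|p]] // _ _.
  rewrite KD21_1 // vector_square_closed [_ + 1]addrC -evenXS.
  rewrite tofracM !tofracD tofracXn tofracM !evenE.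
  have -> : (p.+3 - 1 = p.+2)%N by lia.
  have -> : (2 * p.+3 - 3 = (2 * p + 3))%N by lia.
  have -> : (2 * p.+2 = (2 * p + 3) + 1)%N by lia.
  have e : q ^+ (2 * p + 3) = q ^+ (2 * p.+1) * q.
    by rewrite -exprSr; congr (_ ^+ _); lia.
  by rewrite exprD expr1 e [q ^+ p.+2]exprS (geometric_split _ _ q1 q2).
- case: m m1 m2 m3 {K KE K0} => [|[|[|p]]] // _ _ _.
  have -> : (p.+4 - 2 = p.+2)%N by lia.
  have -> : (2 * p.+4 - 4 = 2 * p.+2)%N by lia.
  by rewrite KD111_1 // KD11E.
- by rewrite KD2_2 ?tofrac1.
- by rewrite KD2_11.
- by case: m m1 {K KE K0} => // p _; rewrite KD2_rec // KD2E.
- by rewrite KD11_2 ?tofrac0.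
- by rewrite KD11_11 ?tofrac1.
- case: m m1 m3 {K KE K0} => [|[|p]] // _ _.
  have -> : (p.+3 - 1 = p.+2)%N by lia.
  have -> : (2 * p.+3 - 2 = 2 * p.+2)%N by lia.
  by rewrite KD11E.
Qed.
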